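(* For $a\in\mathbb{R}^4$ and $\rho>0$ let $U$ be the $4\times 2$ matrix valued function on $\mathbb{R}^4$ $$U(x)=\frac{1}{\sqrt{(x-a)^2+\rho^2}}\begin{pmatrix}(x-a)^\mu\bar\sigma_\mu\\ -\rho\,\mathbb{I}_{2}\end{pmatrix},$$ and let $P=UU^\dagger$, $\Phi(U)=\sum_{\mu=1}^4\mathrm{Tr}(\partial_{x^\mu}P\,\partial_{x^\mu}P)$. For $\alpha>1/2$ the integrals $$g^{0,\alpha}_{ij}=\int_{\mathbb{R}^4}\Phi(U)^\alpha\,\mathrm{Tr}(\partial_iP\,\partial_jP)\,d^4x,$$ where $\partial_i$ runs over derivatives with respect to the five parameters $(a^1,\dots,a^4,\rho)$, converge, and the resulting metric on the five-dimensional parameter space is $$ds^2=\rho^{2(1-\alpha)}A(\alpha)\left(d\vec a^{\,2}+B(\alpha)\,d\rho^2\right),$$ with $$A(\alpha)=4^{2\alpha+1}\pi^2\,(2\alpha-1)\frac{\Gamma(2\alpha-1)}{\Gamma(2\alpha+2)},\qquad B(\alpha)=\frac{2}{2\alpha-1}.$$ In particular, for $\alpha=2$ this metric is, after a constant rescaling of $\rho$, a constant multiple of the (Euclidean) $\mathrm{AdS}_5$ metric $\rho^{-2}(d\vec a^{\,2}+d\rho^2)$.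
   Context: Here $\bar\sigma_\mu=(\mathbb{I}_{2},-i\tau_1,-i\tau_2,-i\tau_3)$ for $\mu=1,\dots,4$, with $\tau_a$ the Pauli matrices; $\mathbb{R}^4$ carries the flat metric and repeated index $\mu$ is summed. $U$ is the ADHM matrix of the $c_2=1$ $SU(2)$ instanton on $\mathbb{R}^4$ with centre $a$ and scale $\rho$; $(a,\rho)\in\mathbb{R}^4\times(0,\infty)$ are coordinates on its moduli space. $d\vec a^{\,2}=\sum_\mu (da^\mu)^2$. *)

(* Defs.v *)
From mathcomp Require Import all_boot all_order all_algebra complex.
From mathcomp Require Import all_classical all_reals all_analysis.

Set Implicit Arguments.
Unset Strict Implicit.
Unset Printing Implicit Defensive.

Import Order.TTheory GRing.Theory Num.Theory.
Import numFieldNormedType.Exports.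

Local Open Scope classical_set_scope.
Local Open Scope ring_scope.
Local Open Scope complex_scope.

Section Definitions.
Context {R : realType}.

Definition mx2 (a b c d : R[i]) : 'M[R[i]]_2 :=
  \matrix_(k, l) nth 0 (nth [::] [:: [:: a; b]; [:: c; d]] k) l.

Definition tau1 : 'M[R[i]]_2 := mx2 0 1 1 0.
Definition tau2 : 'M[R[i]]_2 := mx2 0 (- 'i%C) 'i%C 0.
Definition tau3 : 'M[R[i]]_2 := mx2 1 0 0 (- 1).

(* Indices run from 0, so coordinate [mu : 'I_4] is the usual x^(mu+1) and
   [sigmabar 0] is the identity. *)
Definition sigmabar (mu : 'I_4) : 'M[R[i]]_2 :=
  nth 0 [:: 1%:M; - 'i%C *: tau1; - 'i%C *: tau2; - 'i%C *: tau3] mu.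

Definition normsq n (x : 'rV[R]_n) : R := \sum_mu x 0 mu ^+ 2.

Definition adjoint m n (A : 'M[R[i]]_(m, n)) : 'M[R[i]]_(n, m) :=
  (map_mx Num.conj A)^T.

Definition projector (U : 'M[R[i]]_(2 + 2, 2)) : 'M[R[i]]_(2 + 2) :=
  U *m adjoint U.

(* A complex matrix valued function of real variables is differentiated
   entrywise, real and imaginary parts separately, since [R[i]] is not a
   normed module over [R] in the library. *)
Definition pderiv n m (i : 'I_n.+1) (F : 'rV[R]_n.+1 -> 'M[R[i]]_m)
    (p : 'rV[R]_n.+1) : 'M[R[i]]_m :=
  \matrix_(k, l) ('D_(delta_mx 0 i) (fun q => complex.Re (F q k l)) p +i*
                  'D_(delta_mx 0 i) (fun q => complex.Im (F q k l)) p).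

(* Tr(AB).  It is only applied to derivatives of Hermitian matrices, for which
   the trace is real (lemma [tr_pderiv_real]). *)
Definition trR m (A B : 'M[R[i]]_m) : R := complex.Re (\tr (A *m B)).

Definition Phi (U : 'rV[R]_4 -> 'M[R[i]]_(2 + 2, 2)) (x : 'rV[R]_4) : R :=
  \sum_(mu < 4) trR (pderiv mu (projector \o U) x)
                    (pderiv mu (projector \o U) x).

(* The parameter space R^4 x (0, oo) sits in R^5: [param a rho] is the point
   with coordinates (a^1, ..., a^4, rho). *)
Definition param (a : 'rV[R]_4) (rho : R) : 'rV[R]_(4 + 1) :=
  row_mx a rho%:M.
Definition centre (p : 'rV[R]_(4 + 1)) : 'rV[R]_4 := lsubmx p.
Definition scale (p : 'rV[R]_(4 + 1)) : R := rsubmx p 0 0.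

Definition adhm (p : 'rV[R]_(4 + 1)) (x : 'rV[R]_4) :
    'M[R[i]]_(2 + 2, 2) :=
  let y := x - centre p in
  ((Num.sqrt (normsq y + scale p ^+ 2))^-1)%:C *:
  col_mx (\sum_(mu < 4) (y 0 mu)%:C *: sigmabar mu)
         (- ((scale p)%:C *: 1%:M)).

(* The library has no measure on ['rV[R]_4]; integrals over R^4 are taken
   over R * R * R * R with the product of Lebesgue measures. *)
Definition R4 : Type :=
  (measurableTypeR R * measurableTypeR R * measurableTypeR R *
   measurableTypeR R)%type.
Definition vec4 (t : R * R * R * R) : 'rV[R]_4 :=
  let: (t0, t1, t2, t3) := t in \row_(mu < 4) nth 0 [:: t0; t1; t2; t3] mu.

Definition leb4 : {measure set R4 -> \bar R} :=
  (((@lebesgue_measure R \x @lebesgue_measure R)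
     \x @lebesgue_measure R) \x @lebesgue_measure R)%E.

Definition integrand (alpha : R)
    (U : 'rV[R]_(4 + 1) -> 'rV[R]_4 -> 'M[R[i]]_(2 + 2, 2))
    (p : 'rV[R]_(4 + 1)) (i j : 'I_(4 + 1)) (x : 'rV[R]_4) : R :=
  Phi (U p) x `^ alpha *
  trR (pderiv i (fun q => projector (U q x)) p)
      (pderiv j (fun q => projector (U q x)) p).

(* A metric is given by its symmetric matrix g_ij in the coordinates p. *)
Definition metric (alpha : R)
    (U : 'rV[R]_(4 + 1) -> 'rV[R]_4 -> 'M[R[i]]_(2 + 2, 2))
    (p : 'rV[R]_(4 + 1)) : 'M[R]_(4 + 1) :=
  \matrix_(i, j) \int[leb4]_(t in [set: R4]) integrand alpha U p i j (vec4 t).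

(* [dcoord2 i] is the matrix of the quadratic form (dp^i)^2. *)
Definition dcoord2 (i : 'I_(4 + 1)) : 'M[R]_(4 + 1) := delta_mx i i.
Definition da2 : 'M[R]_(4 + 1) := \sum_(mu < 4) dcoord2 (lshift 1 mu).
Definition drho2 : 'M[R]_(4 + 1) := dcoord2 (rshift 4 ord0).

Definition ads5 (p : 'rV[R]_(4 + 1)) : 'M[R]_(4 + 1) :=
  (scale p ^- 2) *: (da2 + drho2).

(* Jacobians act on row vectors from the right. *)
Definition pullback (f : 'rV[R]_(4 + 1) -> 'rV[R]_(4 + 1))
    (g : 'rV[R]_(4 + 1) -> 'M[R]_(4 + 1)) (p : 'rV[R]_(4 + 1)) :
    'M[R]_(4 + 1) :=
  jacobian f p *m g (f p) *m (jacobian f p)^T.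

Definition rescale (c : R) (p : 'rV[R]_(4 + 1)) : 'rV[R]_(4 + 1) :=
  param (centre p) (c * scale p).

Definition Gamma (s : R) : R :=
  \int[@lebesgue_measure R]_(t in `]0, +oo[) (t `^ (s - 1) * expR (- t)).

Definition metricA (alpha : R) : R :=
  4 `^ (2 * alpha + 1) * pi ^+ 2 * (2 * alpha - 1) *
  (Gamma (2 * alpha - 1) / Gamma (2 * alpha + 2)).

Definition metricB (alpha : R) : R := 2 / (2 * alpha - 1).

Lemma adjoint_projector U : adjoint (projector U) = projector U.
Proof.
rewrite /projector /adjoint map_mxM trmx_mul; congr (_ *m _).
by apply/matrixP => k l; rewrite !mxE; exact: conjCK.
Qed.

Let deriveN_total n (f : 'rV[R]_n.+1 -> R) p v :
  'D_v (- f) p = - 'D_v f p.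
Proof.
have [|ndf] := pselect (derivable f p v); first exact: deriveN.
have ndNf : ~ derivable (- f) p v.
  by move=> dNf; apply: ndf; rewrite -(opprK f); exact: derivableN.
by rewrite /derive (dvgP ndf) (dvgP ndNf) oppr0.
Qed.

Lemma adjoint_pderiv n m (i : 'I_n.+1) (F : 'rV[R]_n.+1 -> 'M[R[i]]_m) p :
  (forall q, adjoint (F q) = F q) -> adjoint (pderiv i F p) = pderiv i F p.
Proof.
move=> hF; apply/matrixP => k l; rewrite !mxE.
have hE q : F q l k = conjc (F q k l).
  by rewrite -[in LHS]hF !mxE.
have -> : (fun q => complex.Re (F q l k)) = (fun q => complex.Re (F q k l)).
  by apply/funext => q; rewrite hE; case: (F q k l).
have -> : (fun q => complex.Im (F q l k)) = - (fun q => complex.Im (F q k l)).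
  by apply/funext => q; rewrite hE [in RHS]fctE; case: (F q k l).
by rewrite deriveN_total; apply/eqP; rewrite eq_complex /= opprK !eqxx.
Qed.

Lemma tr_pderiv_real n m (i j : 'I_n.+1) (F : 'rV[R]_n.+1 -> 'M[R[i]]_m) p :
  (forall q, adjoint (F q) = F q) ->
  \tr (pderiv i F p *m pderiv j F p) =
  (trR (pderiv i F p) (pderiv j F p))%:C.
Proof.
move=> hF; set A := pderiv i F p; set B := pderiv j F p.
have hA : adjoint A = A by exact: adjoint_pderiv.
have hB : adjoint B = B by exact: adjoint_pderiv.
have : conjc (\tr (A *m B)) = \tr (A *m B).
  rewrite -{2}hA -{2}hB /adjoint -trmx_mul mxtrace_tr -map_mxM mxtrace_mulC.
  by rewrite trace_map_mx.
rewrite /trR; case: (\tr _) => x y [] /= /eqP.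
by rewrite eq_sym -subr_eq0 opprK -mulr2n mulrn_eq0 /= => /eqP ->.
Qed.

End Definitions.

(* Main.v *)
Require Import Defs.
From HB Require Import structures.
From mathcomp Require Import all_boot all_order all_algebra complex.
From mathcomp Require Import all_classical all_reals all_analysis.
From mathcomp Require Import measurable_realfun ring lra.

(** Write y = x - a and N = |y|^2 + rho^2.  The projector is
<<
          1  (   |y|^2     - rho y.sigmabar )
     P = --- (                              )
          N  ( - rho (y.sigmabar)^*   rho^2 )
>>
    so its entries are affine in the point (rho^2 / N - 1/2, rho y / N), which
    is the image of y / rho under inverse stereographic projection to the
    four-sphere of radius 1/2, and Tr(dP dP) is four times the round metric of
    that sphere.  Stereographic projection is conformal: for two directions in
    which (y, rho) varies by (w, r) and (w', r'), [trR_pderiv_projector] gives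
<<
     Tr(dP d'P) = 4 / N^2 <rho w - r y, rho w' - r' y>.
>>
    Hence Phi = 16 rho^2 / N^2, and N^2/4 Tr(d_i P d_j P) equals
    rho^2 delta_(mu nu) for two centre coordinates, rho y_mu for a centre
    coordinate and the scale, and |y|^2 for the scale twice.

    The metric coefficients are therefore moments of N^-s over R^4, with
    s = 2 alpha + 2.  The mixed ones vanish because their integrands are odd
    about the centre ([leb4_odd]).  The others follow from
<<
     int N^-s d^4y = pi^2 / ((s - 1) (s - 2)) rho^(4 - 2 s)      (s > 2)
>>
    ([leb4_power]) through |y|^2 = N - rho^2; the condition alpha > 1/2 is what
    makes the exponent 2 alpha + 1 of the slowest integral exceed 2.  In the
    plane such an integral is computed by the substitution y = |x| u followed
    by exchanging the order of integration ([planar_integral]), and the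
    four-dimensional one is two planar ones in succession.  The functional
    equation of Gamma ([Gamma_rec]), obtained by parts, reduces the quotient
    in A(alpha) to 1 / ((2 alpha + 1) (2 alpha)).

    For alpha = 2 the bracket is da^2 + (2/3) drho^2, so multiplying rho by
    sqrt(2/3) makes the metric a multiple of the hyperbolic one. *)

Set Implicit Arguments.
Unset Strict Implicit.
Unset Printing Implicit Defensive.

Import Order.TTheory GRing.Theory Num.Theory.
Import numFieldNormedType.Exports.
Local Open Scope classical_set_scope.
Local Open Scope ring_scope.

(** * Integrals invariant under reflections *)

(** Quantifying over nonnegative integrands only spares all integrability
    conditions and still characterizes invariance of the measure. *)
Definition preserves_integral {R : realType} d (T : measurableType d)
    (m : set T -> \bar R) (p : T -> T) : Prop :=
  forall f : T -> \bar R, measurable_fun [set: T] f -> (forall x, 0 <= f x)%E ->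
    (\int[m]_x f (p x) = \int[m]_x f x)%E.

(** Reflections x |-> a - x are the only isometries of the line that are
    needed: two of them compose to a translation, and one of them gives the
    vanishing of odd integrals. *)
Definition reflection {R : realType} (a : R) (x : measurableTypeR R) :
  measurableTypeR R := a - x.

Lemma measurable_reflect (R : realType) (a : R) :
  measurable_fun [set: measurableTypeR R] (reflection a).
Proof. exact: measurable_funB. Qed.

Lemma lebesgue_measure_reflect (R : realType) (a : R) (A : set R) :
  measurable A ->
  pushforward lebesgue_measure (reflection a) A =
  lebesgue_measure A.
Proof.
move=> mA; apply/esym/lebesgue_measure_unique => //=.
  exact: measurable_reflect.
move=> ? _ [[b c]] _ <-.
rewrite /pushforward.
have -> : reflection a @^-1` `]b, c]%classic = `[a - c, a - b[%classic.
  apply/seteqP; split => x /=; rewrite !in_itv /= /reflection => /andP[h1 h2];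
  by apply/andP; split; lra.
rewrite !lebesgue_measure_itv/= !lte_fin.
by rewrite ltrD2l ltrN2; case: ifPn => // _; rewrite -!EFinD; congr EFin; ring.
Qed.

Lemma reflect_preserves_integral (R : realType) (a : R) :
  preserves_integral (@lebesgue_measure R) (reflection a).
Proof.
move=> f mf f0.
rewrite -[LHS]/(\int[lebesgue_measure]_(x in reflection a @^-1` setT)
  (f \o reflection a) x)%E.
rewrite -ge0_integral_pushforward //; last exact: measurable_reflect.
apply: eq_measure_integral => [|mp A mA _]; first exact: measurable_reflect.
exact: lebesgue_measure_reflect.
Qed.

Definition prod_map (T1 T2 : Type) (p1 : T1 -> T1) (p2 : T2 -> T2)
  (t : T1 * T2) : T1 * T2 := (p1 t.1, p2 t.2).

Lemma measurable_prod_map d1 d2 (T1 : measurableType d1)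
    (T2 : measurableType d2) (p1 : T1 -> T1) (p2 : T2 -> T2) :
  measurable_fun [set: T1] p1 -> measurable_fun [set: T2] p2 ->
  measurable_fun [set: T1 * T2] (prod_map p1 p2).
Proof.
by move=> mp1 mp2; apply: measurable_fun_pair; apply: measurableT_comp.
Qed.

(** The rectangles built from two exhausting sequences of finite measure
    exhaust the product. *)
Lemma sigma_finite_prod (R : realType) d1 d2 (T1 : measurableType d1)
    (T2 : measurableType d2) (m1 : {sigma_finite_measure set T1 -> \bar R})
    (m2 : {sigma_finite_measure set T2 -> \bar R}) :
  sigma_finite [set: T1 * T2] (m1 \x m2)%E.
Proof.
have /sigma_finiteP[F [FT ndF Foo]] := sigma_finiteT m1.
have /sigma_finiteP[G [GT ndG Goo]] := sigma_finiteT m2.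
exists (fun n => F n `*` G n); last first.
  move=> n; have [mF Fn] := Foo n; have [mG Gn] := Goo n.
  split; first exact: measurableX.
  by rewrite product_measure1E// lte_mul_pinfty// ge0_fin_numE.
apply/seteqP; split => // -[x y] _.
have [i _ Fx] : (\bigcup_n F n) x by rewrite -FT.
have [j _ Gy] : (\bigcup_n G n) y by rewrite -GT.
exists (maxn i j) => //; split.
- exact: (subsetPset _ _ (ndF _ _ (leq_maxl i j))).
- exact: (subsetPset _ _ (ndG _ _ (leq_maxr i j))).
Qed.

(** The product bundled with its sigma-finiteness, which Tonelli's theorem
    requires of the first factor of an iterated product. *)
Definition prod_measure (R : realType) d1 d2 (T1 : measurableType d1)
    (T2 : measurableType d2) (m1 : {sigma_finite_measure set T1 -> \bar R})
    (m2 : {sigma_finite_measure set T2 -> \bar R}) :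
  {sigma_finite_measure set (T1 * T2)%type -> \bar R} :=
  HB.pack (m1 \x m2)%E
    (Measure_isSigmaFinite.Build _ _ _ (m1 \x m2)%E (sigma_finite_prod m1 m2)).

(** Tonelli: integrate out the second factor using its invariance, then the
    first. *)
Lemma prod_preserves_integral (R : realType) d1 d2 (T1 : measurableType d1)
    (T2 : measurableType d2) (m1 : {sigma_finite_measure set T1 -> \bar R})
    (m2 : {sigma_finite_measure set T2 -> \bar R}) (p1 : T1 -> T1)
    (p2 : T2 -> T2) :
  measurable_fun setT p1 -> measurable_fun setT p2 ->
  preserves_integral m1 p1 -> preserves_integral m2 p2 ->
  preserves_integral (m1 \x m2)%E (prod_map p1 p2).
Proof.
move=> mp1 mp2 h1 h2 f mf f0.
have mp := measurable_prod_map mp1 mp2.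
rewrite (fubini_tonelli1 (fun t => f (p1 t.1, p2 t.2))) //; last first.
  exact: (measurableT_comp mf mp).
rewrite (fubini_tonelli1 f) // /fubini_F /=.
under eq_integral => x _.
  rewrite (h2 (fun y => f (p1 x, y))) //; last first.
    exact: (measurableT_comp mf (measurable_pair1 _)).
  over.
rewrite (h1 (fun x => \int[m2]_y f (x, y))%E) //.
- exact: (measurable_fun_fubini_tonelli_F f mf).
- by move=> x; apply: integral_ge0.
Qed.

(** * Integrals of powers over the line, the plane and the four-space *)

Lemma cvgy_powRN (R : realType) (p : R) :
  0 < p -> x `^ (- p) @[x --> +oo] --> (0 : R).
Proof.
move=> p0; apply/cvgr0Pnorm_lt => e e0.
near=> x.
have x0 : 0 < x by [].
rewrite ger0_norm ?powR_ge0 // powRN -ltf_pV2 ?posrE ?invr_gt0 ?powR_gt0 //.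
rewrite invrK.
have -> : e^-1 = (e^-1 `^ p^-1) `^ p.
  by rewrite -powRrM mulVf ?gt_eqF // powRr1 // invr_ge0 ltW.
apply: gt0_ltr_powR => //; rewrite ?nnegrE ?powR_ge0 ?ltW //.
Unshelve. all: by end_near. Qed.

Lemma continuous_powR_gt0 (R : realType) (f : R -> R) (s : R) :
  continuous f -> (forall x, 0 < f x) -> continuous (fun x => f x `^ s).
Proof.
move=> cf f0 x.
apply: (@continuous_comp _ _ _ f (fun y => y `^ s)); first exact: cf.
apply/differentiable_continuous/derivable1_diffP.
by apply: derivable_powR; rewrite in_itv /= andbT f0.
Qed.

Lemma quad_gt0 (R : realType) (c k x : R) :
  0 < c -> 0 <= k -> 0 < c + k * x ^+ 2.
Proof. by move=> c0 k0; rewrite ltr_wpDr // mulr_ge0 // sqr_ge0. Qed.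

Lemma continuous_quad (R : realType) (c k : R) :
  continuous (fun x : R => c + k * x ^+ 2).
Proof.
move=> x; apply: cvgD; first exact: cvg_cst.
by apply: cvgM; [exact: cvg_cst|exact: exprn_continuous].
Qed.

Lemma cvgy_quad (R : realType) (c k : R) : 0 < c -> 0 < k ->
  c + k * x ^+ 2 @[x --> +oo] --> +oo.
Proof.
move=> c0 k0; apply/cvgryPge => A; near=> x.
have x1 : 1 <= x by [].
have xA : `|A| / k <= x by [].
apply: (le_trans (ler_norm A)).
move: xA; rewrite ler_pdivrMr // => xA.
apply: (le_trans xA).
have : x * k <= k * x ^+ 2.
  by rewrite mulrC ler_pM2l // expr2 ler_peMl // (le_trans _ x1).
by move=> h; rewrite (le_trans h) // lerDr ltW.
Unshelve. all: by end_near. Qed.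

(** The integrand is even, and on the half-line it is the derivative of - (c +
    k x^2)^(1 - s) / (2 k (s - 1)). *)
Lemma radial_integral (R : realType) (c k s : R) : 0 < c -> 0 < k -> 1 < s ->
  (\int[lebesgue_measure]_x (`|x| * (c + k * x ^+ 2) `^ (- s))%:E =
   (c `^ (1 - s) / (k * (s - 1)))%:E)%E.
Proof.
move=> c0 k0 s1.
have q0 x : 0 < c + k * x ^+ 2 by apply: quad_gt0 => //; exact: ltW.
have cf : continuous (fun x : R => `|x| * (c + k * x ^+ 2) `^ (- s)).
  move=> x; apply: cvgM; first exact: norm_continuous.
  apply: (@continuous_powR_gt0 _ (fun x => c + k * x ^+ 2)) => //.
  exact: continuous_quad.
rewrite ge0_symfun_integralT //; last 2 first.
- by move=> x; rewrite mulr_ge0 // powR_ge0.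
- by move=> x; rewrite /= normrN sqrrN.
rewrite -set_itvcy.
under eq_integral => x.
  rewrite inE /= in_itv /= andbT => x0; rewrite (ger0_norm x0); over.
pose pw := fun y : R => y `^ (- (s - 1)).
pose q := fun x : R => c + k * x ^+ 2.
pose K := - (2 * k * (s - 1))^-1.
have s10 : s - 1 != 0 by rewrite subr_eq0 gt_eqF.
have kn0 : k != 0 by rewrite gt_eqF.
have dF (x : R) :
    is_derive x 1 (K *: (pw \o q)) (x * (c + k * x ^+ 2) `^ (- s)).
  have dq : is_derive x 1 q (2 * k * x).
    apply: is_derive_eq.
    rewrite /GRing.scale /=; ring.
  have dp := @is_derive1_comp _ pw q _ _ _
    (is_derive1_powR (- (s - 1)) (q0 x)) dq.
  apply: is_derive_eq.
  rewrite (_ : - (s - 1) - 1 = - s); last by ring.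
  rewrite /GRing.scale /= /K /q; field.
  exact/andP.
rewrite (@ge0_continuous_FTC2y _ (fun x => x * (c + k * x ^+ 2) `^ (- s))
  (K *: (pw \o q)) 0 0).
- rewrite sub0e -EFinN -EFinM; congr EFin.
  rewrite !fctE /K /pw /q expr0n /= mulr0 addr0 opprB /GRing.scale /=; field.
  exact/andP.
- by move=> x x0; rewrite mulr_ge0 // powR_ge0.
- apply: continuous_subspaceT => x; apply: cvgM; first exact: cvg_id.
  apply: (@continuous_powR_gt0 _ (fun x => c + k * x ^+ 2)) => //.
  exact: continuous_quad.
- rewrite -[X in _ --> X](scaler0 _ K); apply: cvgZr.
  apply: (@cvg_comp _ _ _ q pw _ _ _ (cvgy_quad c0 k0)).
  by apply: cvgy_powRN; rewrite subr_gt0.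
- by move=> x _; apply: ex_derive.
- apply: cvg_at_right_filter.
  apply/differentiable_continuous/derivable1_diffP.
  exact: (@ex_derive _ _ _ _ _ _ _ (dF 0)).
- by move=> x _; rewrite derive1E; apply: derive_val.
Qed.

Lemma integral_dilation (R : realType) (m : R) (G : R -> R) :
  0 < m -> continuous G -> (forall x, 0 <= G x) ->
  (\int[lebesgue_measure]_x (G x)%:E =
   \int[lebesgue_measure]_u (m * G (m * u))%:E)%E.
Proof.
move=> m0 cG G0.
have dm (x : R) : is_derive x 1 ( *%R m) m.
  have -> : *%R m = m *: (@idfun R) by [].
  by apply: is_derive_eq; rewrite /GRing.scale /= mulr1.
have Dm : ( *%R m)^`()%classic = cst m.
  by apply/funext => x; rewrite derive1E; apply: derive_val.
rewrite (@increasing_ge0_integration_by_substitutionT _ ( *%R m) G) //.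
- by apply: eq_integral => x _; rewrite fctE Dm /= mulrC.
- by move=> x y xy; rewrite ltr_pM2l.
- by rewrite Dm => x; exact: cvg_cst.
- by rewrite Dm; exact: is_cvg_cst.
- by rewrite Dm; exact: is_cvg_cst.
- exact: gt0_cvgMrNy.
- exact: gt0_cvgMry.
Qed.

Lemma integral_oneDsqrV (R : realType) :
  (\int[@lebesgue_measure R]_x ((1 + x ^+ 2)^-1)%:E = pi%:E)%E.
Proof.
rewrite (@ge0_symfun_integralT _ (fun x => (1 + x ^+ 2)^-1)).
- have := @integral0y_oneDsqr R; rewrite set_itvcy => ->.
  by rewrite -EFinM; congr EFin; field.
- by move=> x; rewrite invr_ge0 addr_ge0 // sqr_ge0.
- exact: continuous_oneDsqrV.
- by move=> x; rewrite /= sqrrN.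
Qed.

Lemma measurable_sqr_comp (R : realType) d (T : measurableType d) (f : T -> R) :
  measurable_fun [set: T] f -> measurable_fun [set: T] (fun t => f t ^+ 2).
Proof. by move=> mf; exact: (measurableT_comp (exprn_measurable 2)). Qed.

(** For x <> 0 the substitution y = |x| u turns c + x^2 + y^2 into c + (1 +
    u^2) x^2 at the price of a factor |x|.  Integrating over x first leaves a
    multiple of the integral of 1 / (1 + u^2), which is pi. *)
Lemma planar_integral (R : realType) (c s : R) : 0 < c -> 1 < s ->
  (\int[lebesgue_measure]_x \int[lebesgue_measure]_y
     ((c + x ^+ 2 + y ^+ 2) `^ (- s))%:E =
   (pi / (s - 1) * c `^ (1 - s))%:E)%E.
Proof.
move=> c0 s1.
pose h (z : measurableTypeR R * measurableTypeR R) :=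
  ((c + z.1 ^+ 2 + z.2 ^+ 2) `^ (- s))%:E.
pose g (z : measurableTypeR R * measurableTypeR R) :=
  (`|z.1| * (c + (1 + z.2 ^+ 2) * z.1 ^+ 2) `^ (- s))%:E.
have mh : measurable_fun setT h.
  apply/measurable_EFinP; apply: (measurableT_comp (measurable_powR _)).
  apply: measurable_funD; [apply: measurable_funD => //|];
  by apply: measurable_sqr_comp.
have mg : measurable_fun setT g.
  apply/measurable_EFinP; apply: measurable_funM.
    exact: measurableT_comp.
  apply: (measurableT_comp (measurable_powR _)).
  apply: measurable_funD => //.
  apply: measurable_funM; first apply: measurable_funD => //;
  by apply: measurable_sqr_comp.
have g0 z : (0 <= g z)%E by rewrite lee_fin mulr_ge0 // powR_ge0.
have h0 z : (0 <= h z)%E by rewrite lee_fin powR_ge0.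
have mH := measurable_fun_fubini_tonelli_F h mh h0.
have mG := measurable_fun_fubini_tonelli_F g mg g0.
transitivity (\int[lebesgue_measure]_x \int[lebesgue_measure]_y g (x, y))%E.
  (* The substitution degenerates at x = 0, a null set. *)
  rewrite -(@integral_setD1 _ _ 0) //; last 2 first.
  - exact: measurableD.
  - exact: (measurable_funTS (mH lebesgue_measure)).
  rewrite -[RHS](@integral_setD1 _ _ 0) //; last 2 first.
  - exact: measurableD.
  - exact: (measurable_funTS (mG lebesgue_measure)).
  apply: eq_integral => x; rewrite inE /= => -[_ /eqP x0].
  have q0 y : 0 < c + x ^+ 2 + y ^+ 2.
    by rewrite ltr_wpDr ?sqr_ge0 // ltr_wpDr ?sqr_ge0.
  pose G y := (c + x ^+ 2 + y ^+ 2) `^ (- s).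
  have cG : continuous G.
    apply: continuous_powR_gt0 => // y.
    apply: cvgD; first exact: cvg_cst.
    exact: exprn_continuous.
  have G0 y : 0 <= G y by exact: powR_ge0.
  have x1 : 0 < `|x| by rewrite normr_gt0.
  apply: etrans (integral_dilation x1 cG G0) _.
  apply: eq_integral => u _; rewrite /g /G /=; congr (_ * _ `^ _)%:E.
  by rewrite exprMn real_normK ?num_real //; ring.
rewrite -(fubini_tonelli1 g) // (fubini_tonelli2 g) // /fubini_G.
under eq_integral => u _.
  rewrite /g /= radial_integral //; last by rewrite ltr_wpDr ?sqr_ge0.
  rewrite (_ : _ / _ = (c `^ (1 - s) / (s - 1)) * (1 + u ^+ 2)^-1); last first.
    by rewrite invfM mulrCA mulrC.
  rewrite EFinM.
  over.
rewrite ge0_integralZl_EFin //.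
- by rewrite integral_oneDsqrV -EFinM; congr EFin; rewrite mulrC mulrA mulrAC.
- by move=> x _; rewrite lee_fin invr_ge0 addr_ge0 // sqr_ge0.
- apply/measurable_EFinP; apply: continuous_measurable_fun.
  exact: continuous_oneDsqrV.
- by rewrite divr_ge0 ?powR_ge0 // subr_ge0 ltW.
Qed.

Definition reflect4 {R : realType} (a : 'rV[R]_4) (t : @R4 R) : @R4 R :=
  prod_map (prod_map (prod_map (reflection (a 0 (inord 0)))
    (reflection (a 0 (inord 1)))) (reflection (a 0 (inord 2))))
    (reflection (a 0 (inord 3))) t.

(* Unfolding either function would hide the left-hand side of
   [vec4_reflect4]. *)
Arguments reflect4 : simpl never.
Arguments vec4 : simpl never.

Lemma ord4_ind (P : 'I_4 -> Prop) :
  P (inord 0) -> P (inord 1) -> P (inord 2) -> P (inord 3) -> forall i, P i.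
Proof.
move=> P0 P1 P2 P3 [m hm]; move: (hm); case: m hm => [|[|[|[|//]]]] hm hm'.
- by rewrite (_ : Ordinal _ = inord 0) //; apply/val_inj; rewrite /= inordK.
- by rewrite (_ : Ordinal _ = inord 1) //; apply/val_inj; rewrite /= inordK.
- by rewrite (_ : Ordinal _ = inord 2) //; apply/val_inj; rewrite /= inordK.
- by rewrite (_ : Ordinal _ = inord 3) //; apply/val_inj; rewrite /= inordK.
Qed.

Lemma vec4_reflect4 (R : realType) (a : 'rV[R]_4) (t : @R4 R) :
  vec4 (reflect4 a t) = a - vec4 t.
Proof.
case: t => [[[t0 t1] t2] t3]; apply/rowP => i; rewrite !mxE.
by move: i; apply: ord4_ind; rewrite inordK.
Qed.

Lemma measurable_reflect4 (R : realType) (a : 'rV[R]_4) :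
  measurable_fun [set: @R4 R] (reflect4 a).
Proof.
have mr (k : R) := measurable_reflect k.
exact: (measurable_prod_map (measurable_prod_map (measurable_prod_map
  (mr (a 0 (inord 0))) (mr (a 0 (inord 1)))) (mr (a 0 (inord 2))))
  (mr (a 0 (inord 3)))).
Qed.

Definition leb (R : realType) :
  {sigma_finite_measure set (measurableTypeR R) -> \bar R} :=
  @lebesgue_measure R.

Lemma reflect4_preserves_integral (R : realType) (a : 'rV[R]_4) :
  preserves_integral (@leb4 R) (reflect4 a).
Proof.
have hr (k : R) := @reflect_preserves_integral R k.
have mr (k : R) := @measurable_reflect R k.
have m2 := measurable_prod_map (mr (a 0 (inord 0))) (mr (a 0 (inord 1))).
have m3 := measurable_prod_map m2 (mr (a 0 (inord 2))).
(* The measures are named so that the nested products stay folded. *)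
have h2 := prod_preserves_integral (m1 := leb R) (m2 := leb R)
  (mr (a 0 (inord 0))) (mr (a 0 (inord 1)))
  (hr (a 0 (inord 0))) (hr (a 0 (inord 1))).
have h3 := prod_preserves_integral (m1 := prod_measure (leb R) (leb R))
  (m2 := leb R) m2 (mr (a 0 (inord 2))) h2 (hr (a 0 (inord 2))).
exact: (prod_preserves_integral
  (m1 := prod_measure (prod_measure (leb R) (leb R)) (leb R)) (m2 := leb R)
  m3 (mr (a 0 (inord 3))) h3 (hr (a 0 (inord 3)))).
Qed.

Lemma leb4_tonelli (R : realType) (h : @R4 R -> \bar R) :
  measurable_fun [set: @R4 R] h -> (forall t, 0 <= h t)%E ->
  (\int[leb4]_t h t =
   \int[leb R]_x0 \int[leb R]_x1 \int[leb R]_x2 \int[leb R]_x3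
     h (x0, x1, x2, x3))%E.
Proof.
move=> mh h0.
have mh3 := measurable_fun_fubini_tonelli_F (m2 := leb R) h mh h0.
have h30 t : (0 <= fubini_F (leb R) h t)%E by apply: integral_ge0.
have mh2 := measurable_fun_fubini_tonelli_F (m2 := leb R) _ mh3 h30.
have h20 t : (0 <= fubini_F (leb R) (fubini_F (leb R) h) t)%E.
  by apply: integral_ge0.
transitivity
  (\int[prod_measure (prod_measure (leb R) (leb R)) (leb R)]_t
     fubini_F (leb R) h t)%E.
  exact: (fubini_tonelli1
    (m1 := prod_measure (prod_measure (leb R) (leb R)) (leb R)) (m2 := leb R)
    h mh h0).
transitivity
  (\int[prod_measure (leb R) (leb R)]_t
     fubini_F (leb R) (fubini_F (leb R) h) t)%E.
  exact: (fubini_tonelli1 (m1 := prod_measure (leb R) (leb R))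
    (m2 := leb R) _ mh3 h30).
exact: (fubini_tonelli1 (m1 := leb R) (m2 := leb R) _ mh2 h20).
Qed.

(** Since x - a = 0 - (a - x), a translation is the composite of two
    reflections. *)
Lemma leb4_translate (R : realType) (a : 'rV[R]_4) (f : 'rV[R]_4 -> \bar R) :
  measurable_fun [set: @R4 R] (fun t => f (vec4 t)) -> (forall x, 0 <= f x)%E ->
  (\int[leb4]_t f (vec4 t - a)%R = \int[leb4]_t f (vec4 t))%E.
Proof.
move=> mf f0.
rewrite -(reflect4_preserves_integral 0 mf) //.
under [RHS]eq_integral do rewrite /= vec4_reflect4 sub0r.
rewrite -(@reflect4_preserves_integral _ a (fun t => f (- vec4 t))) //.
  by apply: eq_integral => t _ /=; rewrite vec4_reflect4 opprB.
have -> : (fun t : @R4 R => f (- vec4 t)) = (fun t => f (vec4 t)) \o reflect4 0.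
  by apply/funext => t; rewrite /= vec4_reflect4 sub0r.
exact: (measurableT_comp mf (measurable_reflect4 0)).
Qed.

(** The positive part of an odd function is the reflection of its negative
    part, so both have the same integral J.  When J is infinite the value 0 is
    the convention for the real-valued integral of a non-integrable function.
    *)
Lemma leb4_odd (R : realType) (a : 'rV[R]_4) (f : 'rV[R]_4 -> R) :
  measurable_fun [set: @R4 R] (fun t => f (vec4 t)) ->
  (forall x, f (- x) = - f x) ->
  \int[leb4]_(t in [set: @R4 R]) f (vec4 t - a) = 0.
Proof.
move=> mf odd_f; rewrite /Rintegral integralE.
pose F x := (Num.max (f x) 0)%:E.
have F0 x : (0 <= F x)%E by rewrite lee_fin le_max lexx orbT.
have mF : measurable_fun [set: @R4 R] (fun t => F (vec4 t)).
  by apply/measurable_EFinP; apply: measurable_maxr.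
pose J := (\int[leb4]_t F (vec4 t))%E.
transitivity (fine (J - J)).
  congr (fine (_ - _)).
    rewrite /J -(leb4_translate a mF) //.
    by apply: eq_integral => t _; rewrite funeposE -EFin_max.
  rewrite /J -(reflect4_preserves_integral a mF) //.
  apply: eq_integral => t _; rewrite vec4_reflect4 /F -opprB odd_f.
  by rewrite funenegE -EFin_max.
by case: J => //= r; rewrite subrr.
Qed.

Lemma normsq_vec4 (R : realType) (t : @R4 R) :
  normsq (vec4 t) = t.1.1.1 ^+ 2 + t.1.1.2 ^+ 2 + t.1.2 ^+ 2 + t.2 ^+ 2.
Proof.
case: t => [[[t0 t1] t2] t3].
by rewrite /normsq !big_ord_recl big_ord0 !mxE /= addr0 !addrA.
Qed.

Lemma measurable_vec4 (R : realType) (i : 'I_4) :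
  measurable_fun [set: @R4 R] (fun t => vec4 t 0 i).
Proof.
have E (t : @R4 R) : vec4 t 0 i = nth 0 [:: t.1.1.1; t.1.1.2; t.1.2; t.2] i.
  by case: t => [[[t0 t1] t2] t3]; rewrite mxE.
under eq_fun do rewrite E.
move: i E; apply: ord4_ind => _; rewrite inordK //=.
- by do 2! [apply: measurableT_comp => //].
- by do 2! [apply: measurableT_comp => //].
- by apply: measurableT_comp.
- exact: measurable_snd.
Qed.

Lemma measurable_normsq_vec4 (R : realType) :
  measurable_fun [set: @R4 R] (fun t => normsq (vec4 t)).
Proof.
rewrite /normsq; apply: measurable_sum => i.
exact: measurable_sqr_comp (measurable_vec4 i).
Qed.

(** Integrating the last two coordinates by [planar_integral] lowers the
    exponent from s to s - 1 and leaves a planar integral of the same kind. *)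
Lemma leb4_power (R : realType) (c s : R) : 0 < c -> 2 < s ->
  (\int[leb4]_t ((normsq (vec4 t) + c) `^ (- s))%:E =
   (pi ^+ 2 / ((s - 1) * (s - 2)) * c `^ (2 - s))%:E)%E.
Proof.
move=> c0 s2.
pose h (t : @R4 R) := ((normsq (vec4 t) + c) `^ (- s))%:E.
have h0 t : (0 <= h t)%E by rewrite lee_fin powR_ge0.
have mh : measurable_fun setT h.
  apply/measurable_EFinP; apply: (measurableT_comp (measurable_powR _)).
  by apply: measurable_funD => //; exact: measurable_normsq_vec4.
rewrite (leb4_tonelli mh) //.
have q0 (x y : R) : 0 < c + x ^+ 2 + y ^+ 2.
  by rewrite ltr_wpDr ?sqr_ge0 // ltr_wpDr ?sqr_ge0.
have K0 : 0 <= pi / (s - 1) by rewrite divr_ge0 ?pi_ge0 //; lra.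
have mk : measurable_fun
    [set: measurableTypeR R * measurableTypeR R]
    (fun z => ((c + z.1 ^+ 2 + z.2 ^+ 2) `^ (- (s - 1)))%:E).
  apply/measurable_EFinP; apply: (measurableT_comp (measurable_powR _)).
  apply: measurable_funD; [apply: measurable_funD => //|];
  by apply: measurable_sqr_comp.
have k0 z : (0 <= ((c + z.1 ^+ 2 + z.2 ^+ 2) `^ (- (s - 1)))%:E)%E.
  by rewrite lee_fin powR_ge0.
have s1 : 1 < s by lra.
have s11 : 1 < s - 1 by lra.
have E x y : (\int[leb R]_z \int[leb R]_w h (x, y, z, w) =
    (pi / (s - 1))%:E * ((c + x ^+ 2 + y ^+ 2) `^ (- (s - 1)))%:E)%E.
  rewrite -EFinM opprB; apply: etrans (planar_integral (q0 x y) s1).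
  apply: eq_integral => z _; apply: eq_integral => w _.
  by rewrite /h normsq_vec4 /=; congr (_ `^ _)%:E; ring.
have E' x : (\int[leb R]_y \int[leb R]_z \int[leb R]_w h (x, y, z, w) =
    (pi / (s - 1))%:E *
    \int[leb R]_y ((c + x ^+ 2 + y ^+ 2) `^ (- (s - 1)))%:E)%E.
  under eq_integral do rewrite E.
  rewrite ge0_integralZl_EFin //.
    by move=> y _; rewrite lee_fin powR_ge0.
  exact: (measurableT_comp mk (pair1_measurable x)).
under eq_integral do rewrite E'.
rewrite ge0_integralZl_EFin //; last 2 first.
- by move=> x _; apply: integral_ge0 => y _; rewrite lee_fin powR_ge0.
- exact: (measurable_fun_fubini_tonelli_F (m2 := leb R) _ mk k0).
rewrite (planar_integral c0 s11) -EFinM; congr EFin.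
rewrite (_ : 1 - (s - 1) = 2 - s); last by ring.
rewrite (_ : s - 1 - 1 = s - 2); last by ring.
rewrite invfM; ring.
Qed.

(** * The Gamma function *)

(** The Gamma integral with values in the extended reals: the functional
    equation holds there before convergence is known, and convergence is
    deduced from it. *)
Definition gamma_integral {R : realType} (s : R) : \bar R :=
  (\int[lebesgue_measure]_(t in `]0%R, +oo[) (t `^ (s - 1) * expR (- t))%:E)%E.

Lemma measurable_gamma_fun (R : realType) (s : R) (A : set R) :
  measurable_fun A (fun t : R => (t `^ s * expR (- t))%:E).
Proof.
apply: measurable_funTS; apply/measurable_EFinP; apply: measurable_funM => //.
by apply: measurableT_comp => //; exact: measurable_funN.
Qed.

Lemma gamma_fun_ge0 (R : realType) (s t : R) :
  (0 <= (t `^ s * expR (- t))%:E)%E.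
Proof. by rewrite lee_fin mulr_ge0 ?powR_ge0 ?expR_ge0. Qed.

(** Compact intervals exhausting the open half-line, on which integration by
    parts meets neither the singularity of t^(s - 1) at 0 nor the infinite
    end.  The right end is n + 2 so that even the first interval is
    nondegenerate. *)
Definition exhaust {R : realType} (n : nat) : set R :=
  `[n.+1%:R^-1, n.+2%:R].

Lemma exhaust_nondecreasing (R : realType) : nondecreasing_seq (@exhaust R).
Proof.
apply/nondecreasing_seqP => n; apply/subsetPset => t.
rewrite /exhaust /= !in_itv /= => /andP[h1 h2]; apply/andP; split.
  by apply: le_trans h1; rewrite lef_pV2 ?posrE // ler_nat.
by apply: (le_trans h2); rewrite ler_nat.
Qed.

Lemma bigcup_exhaust (R : realType) :
  \bigcup_n @exhaust R n = `]0, +oo[%classic.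
Proof.
apply/seteqP; split => t /=.
  move=> [n _]; rewrite /exhaust /= !in_itv /= andbT => /andP[h _].
  by apply: lt_le_trans h; rewrite invr_gt0.
rewrite in_itv /= andbT => t0.
have tV0 : 0 < t^-1 by rewrite invr_gt0.
exists (maxn (Num.bound t) (Num.bound t^-1)) => //.
rewrite /exhaust /= in_itv /=; apply/andP; split.
  rewrite -[leRHS]invrK lef_pV2 ?posrE //.
  apply/ltW/(lt_le_trans (archi_boundP (ltW tV0))).
  by rewrite ler_nat; apply: (leq_trans (leq_maxr _ _)).
apply/ltW/(lt_le_trans (archi_boundP (ltW t0))).
by rewrite ler_nat; apply: (leq_trans (leq_maxl _ _)); rewrite ltnW.
Qed.

Lemma gamma_integral_cvg (R : realType) (s : R) :
  (\int[lebesgue_measure]_(t in exhaust n) (t `^ (s - 1) * expR (- t))%:E)%E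
    @[n --> \oo] --> gamma_integral s.
Proof.
rewrite /gamma_integral -bigcup_exhaust.
apply: ge0_nondecreasing_set_cvg_integral.
- exact: exhaust_nondecreasing.
- by move=> n; rewrite /exhaust.
- by move=> n; exact: measurable_gamma_fun.
- by move=> n t _; exact: gamma_fun_ge0.
Qed.

(** With k an integer at least s, the term of order k + 1 of the exponential
    series bounds x^s exp(-x) by (k + 1)! / x. *)
Lemma powR_expRN_cvg0 (R : realType) (s : R) :
  x `^ s * expR (- x) @[x --> +oo] --> (0 : R).
Proof.
have [k sk] : exists k : nat, s <= k%:R.
  exists (Num.bound `|s|); apply: (le_trans (ler_norm s)).
  by apply/ltW/archi_boundP.
apply: (@squeeze_cvgr _ _ _ _ (cst 0) (fun x => k.+1`!%:R * x^-1)).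
- near=> x.
  have x1 : 1 <= x by [].
  have x0 : 0 < x by exact: lt_le_trans x1.
  apply/andP; split; first by rewrite mulr_ge0 ?powR_ge0 ?expR_ge0.
  apply: (@le_trans _ _ (x ^+ k * expR (- x))).
    rewrite ler_pM2r ?expR_gt0 // -powR_mulrn ?(ltW x0) //.
    exact: ler_powR.
  have := expR_ge1Dxn k (ltW x0) => h.
  have {}h : x ^+ k.+1 / k.+1`!%:R <= expR x.
    by apply: le_trans h; rewrite lerDr.
  rewrite expRN ler_pdivrMr ?expR_gt0 //.
  rewrite mulrAC ler_pdivlMr // -exprSr mulrC -ler_pdivrMr //.
- exact: cvg_cst.
- rewrite -[X in _ --> X](mulr0 (k.+1`!%:R)); apply: cvgM; first exact: cvg_cst.
  apply/gtr0_cvgV0; last exact: cvg_id.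
  by near=> x.
Unshelve. all: by end_near. Qed.

Lemma gamma_by_parts (R : realType) (s : R) (n : nat) : 0 < s ->
  (\int[lebesgue_measure]_(t in exhaust n) (t `^ s * expR (- t))%:E =
   (n.+1%:R^-1 `^ s * expR (- n.+1%:R^-1)
      - n.+2%:R `^ s * expR (- n.+2%:R))%:E +
   s%:E * \int[lebesgue_measure]_(t in exhaust n)
            (t `^ (s - 1) * expR (- t))%:E)%E.
Proof.
move=> s0; rewrite /exhaust.
set a : R := n.+1%:R^-1; set b : R := n.+2%:R.
have a0 : 0 < a by rewrite invr_gt0.
have ab : a < b.
  by rewrite (@le_lt_trans _ _ 1) // ?invf_le1 // ?ler1n // ltr1n.
have pos t : a <= t -> 0 < t by exact: lt_le_trans.
have dp (p t : R) : 0 < t -> {for t, continuous (fun t : R => t `^ p)}.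
  move=> t0; apply/differentiable_continuous/derivable1_diffP.
  by apply: derivable_powR; rewrite in_itv /= andbT.
have de (t : R) : is_derive t 1 (fun t : R => - expR (- t)) (expR (- t)).
  by apply: is_derive_eq; rewrite mulrN1 opprK.
have ce (t : R) : {for t, continuous (fun t : R => - expR (- t))}.
  by apply/differentiable_continuous/derivable1_diffP/ex_derive.
rewrite (@integration_by_parts _ (fun t => t `^ s) (fun t => - expR (- t))
  (fun t => s * t `^ (s - 1)) (fun t => expR (- t))) //.
- rewrite !mulrN opprK (addrC (- (b `^ s * _))); congr (_ + _)%E.
  under eq_integral do rewrite mulrN EFinN.
  rewrite integral_ge0N; last first.
    move=> t _; rewrite -mulrA lee_fin mulr_ge0 ?(ltW s0) //.
    by rewrite mulr_ge0 ?powR_ge0 ?expR_ge0.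
  rewrite oppeK; under eq_integral do rewrite -mulrA EFinM.
  rewrite ge0_integralZl_EFin //; last by rewrite ltW.
  + by move=> t _; exact: gamma_fun_ge0.
  + exact: measurable_gamma_fun.
- apply: continuous_in_subspaceT => t.
  rewrite inE /= in_itv /= => /andP[/pos t0 _].
  by apply: cvgM; [exact: cvg_cst|exact: dp].
- split.
  + move=> t; rewrite in_itv /= => /andP[/ltW /pos t0 _].
    by apply: derivable_powR; rewrite in_itv /= andbT.
  + by apply: cvg_at_right_filter; exact: dp.
  + by apply: cvg_at_left_filter; apply: dp; exact: lt_trans ab.
- move=> t; rewrite in_itv /= => /andP[/ltW /pos t0 _].
  by rewrite powR_derive1 // in_itv /= andbT.
- apply: continuous_subspaceT => t.
  apply: continuous_comp; first exact: continuousN.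
  exact: continuous_expR.
- split.
  + by move=> t _; apply: ex_derive.
  + by apply: cvg_at_right_filter; exact: ce.
  + by apply: cvg_at_left_filter; exact: ce.
- by move=> t _; rewrite derive1E; apply: derive_val.
Qed.

(** Pass to the limit in [gamma_by_parts]: both boundary terms tend to 0. *)
Lemma gamma_integral_rec (R : realType) (s : R) : 0 < s ->
  gamma_integral (s + 1) = (s%:E * gamma_integral s)%E.
Proof.
move=> s0.
have h1 := @gamma_integral_cvg R (s + 1).
rewrite addrK in h1.
have h2 := @gamma_integral_cvg R s.
have cy k : ((n + k)%:R : R) @[n --> \oo] --> +oo.
  apply/cvgryPge => M; near=> n.
  apply: (@le_trans _ _ n%:R); last by rewrite ler_nat leq_addr.
  by near: n; exact: nbhs_infty_ger.
have bd1 : (n.+1%:R^-1 `^ s * expR (- n.+1%:R^-1) : R) @[n --> \oo] --> (0 : R).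
  apply: (@squeeze_cvgr _ _ _ _ (cst 0) (fun n => (n + 1)%:R `^ (- s))).
  - near=> n; rewrite mulr_ge0 ?powR_ge0 ?expR_ge0 //=.
    rewrite addn1 -powR_inv1 // -powRrM mulN1r ler_piMr ?powR_ge0 //.
  - exact: cvg_cst.
  - exact: (@cvg_comp _ _ _ (fun n => (n + 1)%:R) (fun x : R => x `^ (- s))
      _ _ _ (cy 1) (cvgy_powRN s0)).
have bd2 : (n.+2%:R `^ s * expR (- n.+2%:R) : R) @[n --> \oo] --> (0 : R).
  have -> : (fun n => n.+2%:R `^ s * expR (- n.+2%:R) : R) =
      (fun x : R => x `^ s * expR (- x)) \o (fun n => (n + 2)%:R).
    by apply/funext => n; rewrite fctE addn2.
  have cc := @cvg_comp _ _ _ (fun n => (n + 2)%:R)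
    (fun x : R => x `^ s * expR (- x)) _ _ _ (cy 2) (@powR_expRN_cvg0 R s).
  exact: cc.
have bd := cvgB bd1 bd2; rewrite subr0 in bd.
have h3 : ((n.+1%:R^-1 `^ s * expR (- n.+1%:R^-1)
      - n.+2%:R `^ s * expR (- n.+2%:R))%:E +
   s%:E * \int[lebesgue_measure]_(t in exhaust n)
            (t `^ (s - 1) * expR (- t))%:E)%E @[n --> \oo] -->
   (0%:E + s%:E * gamma_integral s)%E.
  apply: cvgeD => //.
    by apply: cvg_EFin; [near=> n|exact: bd].
  exact: cvgeZl.
rewrite add0e in h3.
rewrite (_ : (fun n => _) = (fun n => \int[lebesgue_measure]_(t in exhaust n)
   (t `^ s * expR (- t))%:E)%E) in h3; last first.
  by apply/funext => n; rewrite (gamma_by_parts n s0).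
exact: (cvg_unique (@ereal_hausdorff R) h1 h3).
Unshelve. all: by end_near. Qed.

Lemma gamma_integral1 (R : realType) : gamma_integral (1 : R) = 1%:E.
Proof.
rewrite /gamma_integral.
under eq_integral do rewrite subrr powRr0 mul1r.
have de (t : R) : is_derive t 1 (fun t : R => - expR (- t)) (expR (- t)).
  by apply: is_derive_eq; rewrite mulrN1 opprK.
have ce (t : R) : {for t, continuous (fun t : R => - expR (- t))}.
  by apply/differentiable_continuous/derivable1_diffP/ex_derive.
rewrite integral_itv_obnd_cbnd; last first.
  by apply/measurable_EFinP/measurable_funTS; apply: measurableT_comp.
rewrite (@ge0_continuous_FTC2y _ (fun t => expR (- t))
  (fun t => - expR (- t)) 0 0).
- by rewrite oppr0 expR0 sub0e EFinN oppeK.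
- by move=> t _; exact: expR_ge0.
- apply: continuous_subspaceT => t.
  apply: continuous_comp; first exact: continuousN.
  exact: continuous_expR.
- by rewrite -oppr0; apply: cvgN; exact: cvgr_expR.
- by move=> t _; apply: ex_derive.
- by apply: cvg_at_right_filter; exact: ce.
- by move=> t _; rewrite derive1E; apply: derive_val.
Qed.

Lemma gamma_integral_fact (R : realType) (n : nat) :
  gamma_integral (n.+1%:R : R) = (n`!%:R)%:E.
Proof.
elim: n => [|n IH]; first exact: gamma_integral1.
by rewrite -[in LHS]natr1 gamma_integral_rec // IH -EFinM -natrM factS.
Qed.

(** For r >= 1 and an integer k + 1 >= r, the integrand is at most the sum of
    those for 1 and k + 1, whose integrals are 0! and k!.  The functional
    equation extends this to all s > 0. *)
Lemma gamma_integral_fin (R : realType) (s : R) : 0 < s ->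
  gamma_integral s \is a fin_num.
Proof.
move=> s0.
have ge1 (r : R) : 1 <= r -> gamma_integral r \is a fin_num.
  move=> r1; pose k := Num.bound r.
  have rk : r <= k.+1%:R.
    apply/ltW/(lt_le_trans (archi_boundP (le_trans ler01 r1))).
    by rewrite ler_nat.
  rewrite ge0_fin_numE; last first.
    by apply: integral_ge0 => t _; exact: gamma_fun_ge0.
  apply: (@le_lt_trans _ _
    (gamma_integral (1 : R) + gamma_integral (k.+1%:R : R))%E).
    rewrite /gamma_integral -ge0_integralD //; last 4 first.
    - by move=> t _; exact: gamma_fun_ge0.
    - exact: measurable_gamma_fun.
    - by move=> t _; exact: gamma_fun_ge0.
    - exact: measurable_gamma_fun.
    apply: ge0_le_integral => //.
    - by move=> t _; exact: gamma_fun_ge0.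
    - exact: measurable_gamma_fun.
    - by apply: emeasurable_funD; exact: measurable_gamma_fun.
    move=> t /=; rewrite in_itv /= andbT => t0.
    rewrite -EFinD lee_fin -mulrDl ler_pM2r ?expR_gt0 // subrr powRr0.
    have [t1|t1] := leP 1 t.
      by rewrite ler_wpDl // ler_powR // lerD2r.
    apply: ler_wpDr; first exact: powR_ge0.
    have one : 1 = 1 `^ (r - 1) :> R by rewrite powR1.
    rewrite [leRHS]one.
    apply: ge0_ler_powR;
      by rewrite ?nnegrE ?subr_ge0 ?(ltW t0) ?(ltW t1) ?ler01.
  by rewrite gamma_integral1 gamma_integral_fact -EFinD ltry.
have := ge1 (s + 1); rewrite lerDr => /(_ (ltW s0)).
rewrite gamma_integral_rec //.
have : (0 <= gamma_integral s)%E.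
  by apply: integral_ge0 => t _; exact: gamma_fun_ge0.
by case: (gamma_integral s) => //=; rewrite gt0_muley ?lte_fin.
Qed.

Lemma GammaE (R : realType) (s : R) : Gamma s = fine (gamma_integral s).
Proof. by []. Qed.

Lemma Gamma_rec (R : realType) (s : R) : 0 < s -> Gamma (s + 1) = s * Gamma s.
Proof.
move=> s0; rewrite !GammaE gamma_integral_rec //.
by rewrite fineM // gamma_integral_fin.
Qed.

(** At s + 1 the integrand t^s exp(-t) is at least exp(-2) on [1, 2]; the
    functional equation then gives the sign at s. *)
Lemma Gamma_gt0 (R : realType) (s : R) : 0 < s -> 0 < Gamma s.
Proof.
move=> s0.
suff : 0 < Gamma (s + 1) by rewrite Gamma_rec // pmulr_rgt0.
have s10 : 0 < s + 1 by exact: addr_gt0.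
rewrite GammaE -lte_fin fineK ?gamma_integral_fin //.
apply: (@lt_le_trans _ _ (expR (- 2))%:E); first by rewrite lte_fin expR_gt0.
apply: (@le_trans _ _
  (\int[lebesgue_measure]_(t in `[1%R, 2%R])
     (t `^ (s + 1 - 1) * expR (- t))%:E)%E).
  rewrite -[leLHS]mule1
    (_ : 1%E = lebesgue_measure `[1%R, 2%R]%classic :> \bar R).
    rewrite -integral_cst //.
    apply: ge0_le_integral => //.
    - by move=> t _; rewrite lee_fin expR_ge0.
    - exact: measurable_gamma_fun.
    move=> t /=; rewrite in_itv /= => /andP[t1 t2]; rewrite lee_fin addrK.
    rewrite -[leLHS]mul1r ler_pM ?ler01 ?expR_ge0 //; last first.
      by rewrite ler_expR lerN2.
    by rewrite -(powRr0 t) ler_powR // ltW.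
  by rewrite lebesgue_measure_itv /= lte_fin ltr1n -EFinD; congr EFin; ring.
apply: ge0_subset_integral => //.
- exact: measurable_gamma_fun.
- by move=> t _; exact: gamma_fun_ge0.
- move=> t /=; rewrite !in_itv /= andbT => /andP[t1 _].
  exact: lt_le_trans t1.
Qed.

(** * Projectors in quaternionic form *)

Local Open Scope complex_scope.

Lemma Re_real_mul (R : realType) (r : R) (z : R[i]) :
  complex.Re (r%:C * z) = r * complex.Re z.
Proof. by case: z => x y /=; rewrite mul0r subr0. Qed.

Lemma Im_real_mul (R : realType) (r : R) (z : R[i]) :
  complex.Im (r%:C * z) = r * complex.Im z.
Proof. by case: z => x y /=; rewrite mul0r addr0. Qed.

Lemma is_derive_lincomb (R : realType) (V : normedModType R) K
    (h : 'I_K -> V -> R) (dh c : 'I_K -> R) (p v : V) :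
  (forall k, is_derive p v (h k) (dh k)) ->
  is_derive p v (fun q => \sum_k h k q * c k) (\sum_k dh k * c k).
Proof.
move=> hd.
have hd' k : is_derive p v (fun q => h k q * c k) (dh k * c k).
  have -> : (fun q => h k q * c k) = c k *: h k.
    by apply/funext => q; rewrite fctE /GRing.scale /= mulrC.
  by rewrite mulrC; exact: is_deriveZ.
have := is_derive_sum hd'.
by congr is_derive; apply/funext => q; rewrite fct_sumE.
Qed.

(** The real and the imaginary part of each entry are combinations, with real
    constants, of the coefficient functions. *)
Lemma pderiv_lincomb (R : realType) n m K (h : 'I_K -> 'rV[R]_n.+1 -> R)
    (dh : 'I_K -> R) (M : 'I_K -> 'M[R[i]]_m) (i : 'I_n.+1) p :
  (forall k, is_derive p (delta_mx 0 i) (h k) (dh k)) ->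
  pderiv i (fun q => \sum_k (h k q)%:C *: M k) p = \sum_k (dh k)%:C *: M k.
Proof.
move=> hd; apply/matrixP => a b; rewrite mxE summxE.
have -> : (fun q => complex.Re ((\sum_k (h k q)%:C *: M k) a b)) =
    (fun q => \sum_k h k q * complex.Re (M k a b)).
  apply/funext => q; rewrite summxE raddf_sum; apply: eq_bigr => k _.
  by rewrite mxE; exact: Re_real_mul.
have -> : (fun q => complex.Im ((\sum_k (h k q)%:C *: M k) a b)) =
    (fun q => \sum_k h k q * complex.Im (M k a b)).
  apply/funext => q; rewrite summxE raddf_sum; apply: eq_bigr => k _.
  by rewrite mxE; exact: Im_real_mul.
have dR := is_derive_lincomb (fun k => complex.Re (M k a b)) hd.
have dI := is_derive_lincomb (fun k => complex.Im (M k a b)) hd.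
rewrite (@derive_val _ _ _ _ _ _ _ dR) (@derive_val _ _ _ _ _ _ _ dI).
apply/eqP; rewrite eq_complex !raddf_sum; apply/andP; split; apply/eqP => /=;
  by apply: eq_bigr => k _; rewrite mxE ?Re_real_mul ?Im_real_mul.
Qed.

Lemma eq_pderiv_entry (R : realType) n m m' (i : 'I_n.+1)
    (F : 'rV[R]_n.+1 -> 'M[R[i]]_m) (G : 'rV[R]_n.+1 -> 'M[R[i]]_m')
    (k l : 'I_m) (k' l' : 'I_m') p :
  (forall q, F q k l = G q k' l') -> pderiv i F p k l = pderiv i G p k' l'.
Proof.
move=> FG; rewrite mxE [RHS]mxE.
have -> : (fun q => complex.Re (F q k l)) = (fun q => complex.Re (G q k' l')).
  by apply/funext => q; rewrite FG.
have -> // : (fun q => complex.Im (F q k l)) =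
    (fun q => complex.Im (G q k' l')).
by apply/funext => q; rewrite FG.
Qed.

Lemma pderiv_block (R : realType) n m (i : 'I_n.+1)
    (A B C D : 'rV[R]_n.+1 -> 'M[R[i]]_m) p :
  pderiv i (fun q => block_mx (A q) (B q) (C q) (D q)) p =
  block_mx (pderiv i A p) (pderiv i B p) (pderiv i C p) (pderiv i D p).
Proof.
set F := fun q => block_mx _ _ _ _.
rewrite -[LHS]submxK; congr block_mx; apply/matrixP => k l.
- by rewrite 2!mxE; apply: eq_pderiv_entry => q; exact: block_mxEul.
- by rewrite 2!mxE; apply: eq_pderiv_entry => q; exact: block_mxEur.
- by rewrite 2!mxE; apply: eq_pderiv_entry => q; exact: block_mxEdl.
- by rewrite 2!mxE; apply: eq_pderiv_entry => q; exact: block_mxEdr.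
Qed.

(** The quaternion y.sigmabar as a complex 2 x 2 matrix; [quatc] is its
    conjugate. *)
Definition quat {R : realType} (y : 'I_4 -> R) : 'M[R[i]]_2 :=
  \sum_mu (y mu)%:C *: sigmabar mu.

Definition quatc {R : realType} (y : 'I_4 -> R) : 'M[R[i]]_2 :=
  \sum_mu (y mu)%:C *: adjoint (sigmabar mu).

Definition dot4 {R : realType} (y z : 'I_4 -> R) : R := \sum_mu y mu * z mu.

Lemma big_ord4 (V : nmodType) (F : 'I_4 -> V) :
  \sum_mu F mu = F 0 + F 1 + F (inord 2) + F (inord 3).
Proof.
rewrite !big_ord_recl big_ord0 addr0 !addrA.
by congr (_ + F _ + F _ + F _); apply/val_inj; rewrite //= inordK.
Qed.

Lemma dot4C (R : realType) (y z : 'I_4 -> R) : dot4 y z = dot4 z y.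
Proof. by apply: eq_bigr => mu _; rewrite mulrC. Qed.

Lemma adjoint_quat (R : realType) (y : 'I_4 -> R) :
  adjoint (quat y) = quatc y.
Proof.
apply/matrixP => k l; rewrite !mxE !summxE rmorph_sum.
apply: eq_bigr => mu _; rewrite !mxE rmorphM /=; congr (_ * _).
exact: conjc_real.
Qed.

Lemma quatE (R : realType) (y : 'I_4 -> R) :
  let y0 := y 0 in let y1 := y 1 in let y2 := y (inord 2) in
  let y3 := y (inord 3) in
  quat y = mx2 (y0 +i* - y3) (- y2 +i* - y1) (y2 +i* - y1) (y0 +i* y3).
Proof.
move=> y0 y1 y2 y3.
rewrite /quat big_ord4 /sigmabar !inordK //=.
apply/matrixP => k l; rewrite !mxE.
case: k => [[|[|//]]] hk; case: l => [[|[|//]]] hl /=;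
  by apply/eqP; rewrite eq_complex /=; apply/andP; split; apply/eqP;
     rewrite -/y0 -/y1 -/y2 -/y3; ring.
Qed.

Lemma adjoint_mx2 (R : realType) (a b c d : R[i]) :
  adjoint (mx2 a b c d) = mx2 (conjc a) (conjc c) (conjc b) (conjc d).
Proof.
apply/matrixP => k l; rewrite !mxE.
by case: k => [[|[|//]]] hk; case: l => [[|[|//]]] hl.
Qed.

Lemma mul_mx2 (R : realType) (a b c d e f g h : R[i]) :
  mx2 a b c d *m mx2 e f g h =
  mx2 (a * e + b * g) (a * f + b * h) (c * e + d * g) (c * f + d * h).
Proof.
apply/matrixP => k l; rewrite !mxE !big_ord_recl big_ord0 addr0 !mxE.
by case: k => [[|[|//]]] hk; case: l => [[|[|//]]] hl.
Qed.

Lemma tr_mx2 (R : realType) (a b c d : R[i]) : \tr (mx2 a b c d) = a + d.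
Proof. by rewrite /mxtrace !big_ord_recl big_ord0 addr0 !mxE. Qed.

Lemma dot4E (R : realType) (y z : 'I_4 -> R) :
  dot4 y z = y 0 * z 0 + y 1 * z 1 + y (inord 2) * z (inord 2) +
             y (inord 3) * z (inord 3).
Proof. exact: big_ord4. Qed.

Lemma quat_quatc (R : realType) (y : 'I_4 -> R) :
  quat y *m quatc y = ((dot4 y y)%:C)%:M.
Proof.
rewrite -adjoint_quat quatE adjoint_mx2 mul_mx2 dot4E.
apply/matrixP => k l; rewrite !mxE.
by case: k => [[|[|//]]] hk; case: l => [[|[|//]]] hl /=;
  apply/eqP; rewrite eq_complex /=; apply/andP; split; apply/eqP;
  rewrite ?mulr0n ?mulr1n /=; ring.
Qed.

Lemma Re_tr_quat (R : realType) (y z : 'I_4 -> R) :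
  complex.Re (\tr (quat y *m quatc z)) = 2 * dot4 y z.
Proof.
rewrite -adjoint_quat !quatE adjoint_mx2 mul_mx2 tr_mx2 dot4E /=; ring.
Qed.

(** The matrices among which the projector moves.  Keeping the two diagonal
    coefficients independent makes [projector_adhm] valid also where N = 0. *)
Definition projector_mx {R : realType} (b c : R) (s : 'I_4 -> R) :
    'M[R[i]]_(2 + 2) :=
  block_mx (b%:C)%:M (- quat s) (- quatc s) (c%:C)%:M.

(** The quaternionic basis matrices are orthogonal for the trace form. *)
Lemma trR_projector_mx (R : realType) (b c b' c' : R) (s s' : 'I_4 -> R) :
  trR (projector_mx b c s) (projector_mx b' c' s') =
  2 * (b * b') + 2 * (c * c') + 4 * dot4 s s'.
Proof.
rewrite /trR /projector_mx mulmx_block mxtrace_block.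
rewrite !mulNmx !mulmxN !opprK !mxtraceD -!scalar_mxM !mxtrace_scalar.
rewrite (mxtrace_mulC (quatc s)) !raddfD /=.
rewrite (Re_tr_quat s s') (Re_tr_quat s' s).
rewrite (dot4C s' s); ring.
Qed.

Lemma quatZ (R : realType) (a : R) (y : 'I_4 -> R) :
  quat (fun mu => a * y mu) = a%:C *: quat y.
Proof.
rewrite /quat scaler_sumr; apply: eq_bigr => mu _.
by rewrite scalerA -rmorphM.
Qed.

Lemma quatcZ (R : realType) (a : R) (y : 'I_4 -> R) :
  quatc (fun mu => a * y mu) = a%:C *: quatc y.
Proof.
rewrite /quatc scaler_sumr; apply: eq_bigr => mu _.
by rewrite scalerA -rmorphM.
Qed.

Lemma adjointZ (R : realType) m n (a : R) (A : 'M[R[i]]_(m, n)) :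
  adjoint (a%:C *: A) = a%:C *: adjoint A.
Proof.
apply/matrixP => k l; rewrite !mxE rmorphM; congr (_ * _); exact: conjc_real.
Qed.

Lemma adjoint_col_mx (R : realType) m1 m2 n (A : 'M[R[i]]_(m1, n))
    (B : 'M[R[i]]_(m2, n)) :
  adjoint (col_mx A B) = row_mx (adjoint A) (adjoint B).
Proof. by rewrite /adjoint map_col_mx tr_col_mx. Qed.

Lemma adjoint_real_scalar (R : realType) n (a : R) :
  adjoint ((a%:C)%:M : 'M[R[i]]_n) = (a%:C)%:M.
Proof.
apply/matrixP => k l; rewrite !mxE rmorphMn eq_sym; congr (_ *+ _).
exact: conjc_real.
Qed.

(** The square root of N occurs twice in U U^*, and S S^* = |y|^2.  At N = 0
    both sides vanish, because 0^-1 = 0. *)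
Lemma projector_adhm (R : realType) (p : 'rV[R]_(4 + 1)) (x : 'rV[R]_4) :
  let y := x - centre p in let N := normsq y + scale p ^+ 2 in
  projector (adhm p x) =
  projector_mx (normsq y / N) (scale p ^+ 2 / N)
    (fun mu => scale p * y 0 mu / N).
Proof.
move=> y N; rewrite /projector /adhm -/y -/N.
have N0 : 0 <= N.
  by rewrite addr_ge0 ?sqr_ge0 // sumr_ge0 // => mu _; exact: sqr_ge0.
set k := (Num.sqrt N)^-1.
have kk : k * k = N^-1 by rewrite -invfM -expr2 sqr_sqrtr.
set r := scale p.
have -> : \sum_(mu < 4) (y 0 mu)%:C *: sigmabar mu =
    quat (fun mu => y 0 mu) by [].
set S := quat _.
rewrite adjointZ adjoint_col_mx scalemx1 -scaleN1r.
have -> : (-1 *: (r%:C)%:M : 'M[R[i]]_2) = ((- r)%:C)%:M.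
  by rewrite scale_scalar_mx mulN1r -rmorphN.
rewrite adjoint_real_scalar adjoint_quat.
rewrite -scalemxAl -scalemxAr scalerA mul_col_row scale_block_mx.
rewrite -rmorphM kk /projector_mx.
have -> : (fun mu => r * y 0 mu / N) = (fun mu => (r / N) * y 0 mu).
  by apply/funext => mu; rewrite mulrAC.
rewrite quatZ quatcZ -/S; congr block_mx.
- rewrite quat_quatc scale_scalar_mx -rmorphM mulrC.
  by congr ((_ / _)%:C)%:M; apply: eq_bigr => mu _; rewrite expr2.
- rewrite mul_mx_scalar scalerA -rmorphM mulrN rmorphN scaleNr.
  by rewrite [N^-1 * r]mulrC.
- rewrite mul_scalar_mx scalerA -rmorphM mulrN rmorphN scaleNr.
  by rewrite [N^-1 * r]mulrC.
- rewrite -scalar_mxM scale_scalar_mx -!rmorphM; congr (_%:C)%:M.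
  by rewrite mulrNN mulrC expr2.
Qed.

Lemma pderiv_projector_mx (R : realType) n (i : 'I_n.+1)
    (b c : 'rV[R]_n.+1 -> R) (s : 'I_4 -> 'rV[R]_n.+1 -> R) p
    (db dc : R) (ds : 'I_4 -> R) :
  is_derive p (delta_mx 0 i) b db -> is_derive p (delta_mx 0 i) c dc ->
  (forall mu, is_derive p (delta_mx 0 i) (s mu) (ds mu)) ->
  pderiv i (fun q => projector_mx (b q) (c q) (fun mu => s mu q)) p =
  projector_mx db dc ds.
Proof.
move=> hb hc hs; rewrite /projector_mx pderiv_block.
have scal (f : 'rV[R]_n.+1 -> R) df : is_derive p (delta_mx 0 i) f df ->
    pderiv i (fun q => ((f q)%:C)%:M : 'M[R[i]]_2) p = (df%:C)%:M.
  move=> hf.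
  have -> : (fun q => ((f q)%:C)%:M : 'M[R[i]]_2) =
      (fun q => \sum_(k < 1) (f q)%:C *: 1%:M).
    by apply/funext => q; rewrite big_ord1 scalemx1.
  rewrite (@pderiv_lincomb _ _ _ 1 (fun=> f) (fun=> df)) //.
  by rewrite big_ord1 scalemx1.
have lin (M : 'I_4 -> 'M[R[i]]_2) :
    pderiv i (fun q => - \sum_mu (s mu q)%:C *: M mu) p =
    - \sum_mu (ds mu)%:C *: M mu.
  have -> : (fun q => - \sum_mu (s mu q)%:C *: M mu) =
      (fun q => \sum_mu (s mu q)%:C *: - M mu).
    apply/funext => q; rewrite -sumrN; apply: eq_bigr => mu _.
    by rewrite scalerN.
  rewrite (pderiv_lincomb _ hs) -sumrN.
  by apply: eq_bigr => mu _; rewrite scalerN.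
by rewrite (scal _ _ hb) (scal _ _ hc) /quat /quatc !lin.
Qed.

(** * Conformality of the stereographic projection *)

Lemma is_derive_mul (R : realType) (V : normedModType R) (f g : V -> R) p v
    (df dg : R) : is_derive p v f df -> is_derive p v g dg ->
  is_derive p v (fun q => f q * g q) (df * g p + f p * dg).
Proof.
move=> hf hg; have := is_deriveM hf hg; rewrite /GRing.scale /=.
by rewrite addrC [g p * df]mulrC.
Qed.

Lemma is_derive_inv (R : realType) (V : normedModType R) (f : V -> R) p v
    (df : R) : f p != 0 -> is_derive p v f df ->
  is_derive p v (fun q => (f q)^-1) (- df / f p ^+ 2).
Proof.
move=> f0 [df1 <-]; split; first exact: derivableV.
by rewrite deriveV // /GRing.scale /= mulNr mulrC mulNr.
Qed.

Section stereographic.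
Context (R : realType) (V : normedModType R) (p v : V).
Context (y : 'I_4 -> V -> R) (r : V -> R) (w : 'I_4 -> R) (r' : R).
Context (hy : forall mu, is_derive p v (y mu) (w mu)).
Context (hr : is_derive p v r r').

Let n2 q := dot4 (y^~ q) (y^~ q).
Let N q := n2 q + r q ^+ 2.
Context (N0 : N p != 0).
Let d mu := r p * w mu - r' * y mu p.
Let e := dot4 (y^~ p) d.

Let dn2 : is_derive p v n2 (2 * dot4 (y^~ p) w).
Proof.
have h mu : is_derive p v (fun q => y mu q * y mu q)
    (w mu * y mu p + y mu p * w mu) by exact: is_derive_mul.
have := is_derive_sum h.
rewrite (_ : \sum_i _ = 2 * dot4 (y^~ p) w); last first.
  rewrite /dot4 mulr_sumr; apply: eq_bigr => mu _; ring.
by congr is_derive; apply/funext => q; rewrite fct_sumE.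
Qed.

Let dr2 : is_derive p v (fun q => r q ^+ 2) (2 * r p * r').
Proof.
have := is_derive_mul hr hr.
by rewrite (_ : _ + _ = 2 * r p * r'); last ring.
Qed.

Let dNV : is_derive p v (fun q => (N q)^-1)
  (- (2 * dot4 (y^~ p) w + 2 * r p * r') / N p ^+ 2).
Proof. by apply: is_derive_inv => //; exact: is_deriveD. Qed.

Let eE : e = r p * dot4 (y^~ p) w - r' * n2 p.
Proof.
rewrite /e /dot4 /n2 /dot4 !mulr_sumr -sumrB; apply: eq_bigr => mu _.
rewrite /d; ring.
Qed.

(** The derivatives of the three kinds of coefficients are written in terms of
    d = r w - r' y, which is r^2 times the variation of y / r, and of e = <y,
    d>. *)
Lemma is_derive_north :
  is_derive p v (fun q => n2 q / N q) (2 * r p * e / N p ^+ 2).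
Proof.
have := is_derive_mul dn2 dNV; congr (is_derive _ _ _ _).
rewrite eE /N; field; exact: N0.
Qed.

Lemma is_derive_south :
  is_derive p v (fun q => r q ^+ 2 / N q) (- (2 * r p * e / N p ^+ 2)).
Proof.
have := is_derive_mul dr2 dNV; congr (is_derive _ _ _ _).
rewrite eE /N; field; exact: N0.
Qed.

Lemma is_derive_equator mu :
  is_derive p v (fun q => r q * y mu q / N q)
    (d mu / N p - 2 * y mu p * e / N p ^+ 2).
Proof.
have := is_derive_mul (is_derive_mul hr (hy mu)) dNV.
congr (is_derive _ _ _ _).
rewrite eE /d /N; field; exact: N0.
Qed.

End stereographic.

(** Conformality of the stereographic projection: the terms in e e' cancel
    because |y|^2 + r^2 = N. *)
Lemma conformal_identity (R : realType) (y d d' : 'I_4 -> R) (r N : R) :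
  N = dot4 y y + r ^+ 2 -> N != 0 ->
  let e := dot4 y d in let e' := dot4 y d' in
  2 * (2 * r * e / N ^+ 2 * (2 * r * e' / N ^+ 2)) +
  2 * (- (2 * r * e / N ^+ 2) * - (2 * r * e' / N ^+ 2)) +
  4 * dot4 (fun mu => d mu / N - 2 * y mu * e / N ^+ 2)
           (fun mu => d' mu / N - 2 * y mu * e' / N ^+ 2) =
  4 / N ^+ 2 * dot4 d d'.
Proof.
move=> NE N0 e e'.
have -> : dot4 (fun mu => d mu / N - 2 * y mu * e / N ^+ 2)
           (fun mu => d' mu / N - 2 * y mu * e' / N ^+ 2) =
  dot4 d d' / N ^+ 2 - 4 * e * e' / N ^+ 3 + 4 * dot4 y y * e * e' / N ^+ 4.
  have sumE : forall a b c f : R,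
    a * dot4 d d' + b * e + c * e' + f * dot4 y y =
    \sum_mu (a * (d mu * d' mu) + b * (y mu * d mu) + c * (y mu * d' mu)
             + f * (y mu * y mu)).
    by move=> a b c f; rewrite !big_split /= !mulr_sumr.
  transitivity (N ^- 2 * dot4 d d' + (- 2 * e' / N ^+ 3) * e +
    (- 2 * e / N ^+ 3) * e' + (4 * e * e' / N ^+ 4) * dot4 y y); last first.
    by field.
  rewrite sumE; apply: eq_bigr => mu _; field; exact: N0.
have -> : dot4 y y = N - r ^+ 2 by rewrite NE; ring.
by field.
Qed.

Lemma is_derive_coord (R : realType) n (p v : 'rV[R]_n.+1) (j : 'I_n.+1) :
  is_derive p v (fun q : 'rV[R]_n.+1 => q 0 j) (v 0 j).
Proof.
have did : derivable (@idfun 'rV[R]_n.+1) p v by exact: derivable_id.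
split; first exact: (derivable_mxP _ _ _).1 did 0 j.
by rewrite -[in RHS](derive_id p v) (derive_mx did) mxE.
Qed.

Lemma normsq_dot4 (R : realType) (y : 'rV[R]_4) :
  normsq y = dot4 (y 0) (y 0).
Proof. by apply: eq_bigr => mu _; rewrite expr2. Qed.

(** The metric induced by P in arbitrary coordinates q on which y and the
    scale r depend; it covers both the derivatives in x and those in the
    parameters. *)
Lemma trR_pderiv_projector (R : realType) n (i j : 'I_n.+1) (p : 'rV[R]_n.+1)
    (F : 'rV[R]_n.+1 -> 'M[R[i]]_(2 + 2))
    (y : 'I_4 -> 'rV[R]_n.+1 -> R) (r : 'rV[R]_n.+1 -> R)
    (w : 'I_n.+1 -> 'I_4 -> R) (r' : 'I_n.+1 -> R) :
  let N q := dot4 (y^~ q) (y^~ q) + r q ^+ 2 in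
  let d k mu := r p * w k mu - r' k * y mu p in
  (forall q, F q = projector_mx (dot4 (y^~ q) (y^~ q) / N q) (r q ^+ 2 / N q)
                     (fun mu => r q * y mu q / N q)) ->
  (forall k mu, is_derive p (delta_mx 0 k) (y mu) (w k mu)) ->
  (forall k, is_derive p (delta_mx 0 k) r (r' k)) ->
  N p != 0 ->
  trR (pderiv i F p) (pderiv j F p) = 4 / N p ^+ 2 * dot4 (d i) (d j).
Proof.
move=> N d /funext -> hy hr N0.
have E k := pderiv_projector_mx (is_derive_north (hy k) (hr k) N0)
  (is_derive_south (hy k) (hr k) N0) (is_derive_equator (hy k) (hr k) N0).
rewrite !E trR_projector_mx.
exact: conformal_identity.
Qed.

Lemma scale_param (R : realType) (a : 'rV[R]_4) (rho : R) :
  scale (param a rho) = rho.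
Proof. by rewrite /scale /param row_mxKr mxE eqxx. Qed.

Lemma centre_param (R : realType) (a : 'rV[R]_4) (rho : R) :
  centre (param a rho) = a.
Proof. by rewrite /centre /param row_mxKl. Qed.

Lemma dot4_delta (R : realType) (k : 'I_4) (c : R) (y : 'I_4 -> R) :
  dot4 (fun mu => c * (mu == k)%:R) y = c * y k.
Proof.
rewrite /dot4 (bigD1 k) //= eqxx mulr1 big1 ?addr0 // => mu /negbTE ->.
by rewrite mulr0 mul0r.
Qed.

Section adhm_derivatives.
Context (R : realType) (a x : 'rV[R]_4) (rho : R) (rho0 : 0 < rho).
Let N := normsq (x - a) + rho ^+ 2.

Let N0 : N != 0.
Proof.
by rewrite gt_eqF // ltr_wpDl ?exprn_gt0 // sumr_ge0 // => mu _; exact: sqr_ge0.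
Qed.

Lemma Phi_adhm : Phi (adhm (param a rho)) x = 16 * rho ^+ 2 / N ^+ 2.
Proof.
rewrite /Phi.
pose w (k mu : 'I_4) : R := (mu == k)%:R.
have h (mu : 'I_4) : trR (pderiv mu (projector \o adhm (param a rho)) x)
    (pderiv mu (projector \o adhm (param a rho)) x) = 4 / N ^+ 2 * rho ^+ 2.
  have hy k l : is_derive x (delta_mx 0 k) (fun q : 'rV[R]_4 => (q - a) 0 l)
      (w k l).
    have -> : (fun q : 'rV[R]_4 => (q - a) 0 l) =
        (fun q : 'rV[R]_4 => q 0 l) - cst (a 0 l).
      by apply/funext => q; rewrite !mxE.
    have := is_deriveB (is_derive_coord x (delta_mx 0 k) l)
      (is_derive_cst (a 0 l) x (delta_mx 0 k)).
    by rewrite mxE eqxx subr0.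
  have hr k := is_derive_cst rho x (delta_mx 0 k : 'rV[R]_4).
  apply: etrans (trR_pderiv_projector mu mu _ hy hr _) _.
  - by move=> q /=; rewrite projector_adhm scale_param centre_param normsq_dot4.
  - by rewrite -normsq_dot4.
  - rewrite /N normsq_dot4; congr (_ * _).
    under eq_fun do rewrite mul0r subr0.
    by rewrite dot4_delta /w eqxx mulr1 expr2.
rewrite (eq_bigr _ (fun mu _ => h mu)) sumr_const card_ord -mulr_natl; field.
exact: N0.
Qed.

Lemma trR_param (i j : 'I_(4 + 1)) :
  let d (k : 'I_(4 + 1)) (mu : 'I_4) : R :=
    rho * (- (lshift 1 mu == k)%:R) - (rshift 4 ord0 == k)%:R * (x - a) 0 mu in
  trR (pderiv i (fun q => projector (adhm q x)) (param a rho))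
      (pderiv j (fun q => projector (adhm q x)) (param a rho)) =
  4 / N ^+ 2 * dot4 (d i) (d j).
Proof.
move=> d.
have hy k mu : is_derive (param a rho) (delta_mx 0 k)
    (fun q : 'rV[R]_(4 + 1) => (x - centre q) 0 mu) (- (lshift 1 mu == k)%:R).
  have -> : (fun q : 'rV[R]_(4 + 1) => (x - centre q) 0 mu) =
      cst (x 0 mu) - (fun q : 'rV[R]_(4 + 1) => q 0 (lshift 1 mu)).
    by apply/funext => q; rewrite !mxE.
  have := is_deriveB
    (is_derive_cst (x 0 mu) (param a rho) (delta_mx 0 k : 'rV[R]_(4 + 1)))
    (is_derive_coord (param a rho) (delta_mx 0 k) (lshift 1 mu)).
  by rewrite mxE eqxx sub0r.
have hr k : is_derive (param a rho) (delta_mx 0 k : 'rV[R]_(4 + 1)) scale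
    (rshift 4 ord0 == k)%:R.
  have -> : scale = (fun q : 'rV[R]_(4 + 1) => q 0 (rshift 4 ord0)).
    by apply/funext => q; rewrite /scale mxE.
  have := is_derive_coord (param a rho) (delta_mx 0 k) (rshift 4 ord0).
  by rewrite mxE eqxx.
apply: etrans (trR_pderiv_projector i j _ hy hr _) _.
- by move=> q; rewrite projector_adhm normsq_dot4.
- by rewrite scale_param centre_param -normsq_dot4.
- by rewrite scale_param centre_param -normsq_dot4.
Qed.

End adhm_derivatives.

(** * Pull-back of the hyperbolic metric *)

Local Close Scope complex_scope.

Lemma mulmxr_continuous (R : realType) m n (M : 'M[R]_(m, n)) :
  continuous (mulmxr M : 'rV[R]_m -> 'rV[R]_n).
Proof.
have -> : (mulmxr M : 'rV[R]_m -> 'rV[R]_n) =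
    (fun q => \sum_i q 0 i *: row i M).
  by apply/funext => q; rewrite /= mulmx_sum_row.
apply: continuous_big => [|i _ q]; first exact: add_continuous.
apply: (@continuous_comp _ _ _ (fun q : 'rV[R]_m => q 0 i)
  (fun k : R => k *: row i M)).
  exact: coord_continuous.
exact: scalel_continuous.
Qed.

Lemma jacobian_mulmxr (R : realType) m n (M : 'M[R]_(m, n)) (p : 'rV[R]_m) :
  jacobian (mulmxr M) p = M.
Proof.
apply/matrixP => i j.
by rewrite mxE (diff_lin _ (@mulmxr_continuous _ _ _ M)) /= -rowE mxE.
Qed.

Definition rescale_mx {R : realType} (c : R) : 'M[R]_(4 + 1) :=
  block_mx 1%:M 0 0 c%:M.

Lemma rescaleE (R : realType) (c : R) : rescale c = mulmxr (rescale_mx c).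
Proof.
apply/funext => q; rewrite /= -[q in RHS]hsubmxK /rescale_mx mul_row_block.
rewrite !mulmx0 addr0 add0r mulmx1 /rescale /param /centre /scale.
congr row_mx; rewrite mul_mx_scalar; apply/matrixP => k l.
by rewrite !ord1 !mxE eqxx mulr1n.
Qed.

Lemma da2E (R : realType) : @da2 R = block_mx 1%:M 0 0 0.
Proof.
rewrite /da2 /dcoord2; apply/matrixP => k l; rewrite summxE.
rewrite -(splitK k) -(splitK l); case: (fintype.split k) => k1;
  case: (fintype.split l) => l1 /=;
  rewrite ?(block_mxEul, block_mxEur, block_mxEdl, block_mxEdr) !mxE.
- rewrite (bigD1 k1) //= mxE eqxx (inj_eq (@lshift_inj _ _)) /=.
  rewrite big1 ?addr0 ?[l1 == k1]eq_sym // => mu; rewrite eq_sym => /negbTE h.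
  by rewrite mxE (inj_eq (@lshift_inj _ _)) h.
- by rewrite big1 // => mu _; rewrite mxE eq_rlshift andbF.
- by rewrite big1 // => mu _; rewrite mxE eq_rlshift.
- by rewrite big1 // => mu _; rewrite mxE eq_rlshift.
Qed.

Lemma drho2E (R : realType) : @drho2 R = block_mx 0 0 0 1%:M.
Proof.
rewrite /drho2 /dcoord2; apply/matrixP => k l.
rewrite -(splitK k) -(splitK l); case: (fintype.split k) => k1;
  case: (fintype.split l) => l1 /=;
  rewrite ?(block_mxEul, block_mxEur, block_mxEdl, block_mxEdr) !mxE
    ?eq_lrshift ?andbF //.
by rewrite !ord1 !eqxx.
Qed.

(** The Jacobian of the rescaling is diag(1, 1, 1, 1, c). *)
Lemma pullback_ads5 (R : realType) (c rho : R) (a : 'rV[R]_4) :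
  pullback (rescale c) ads5 (param a rho) =
  ((c * rho) ^- 2) *: (da2 + c ^+ 2 *: drho2).
Proof.
rewrite /pullback rescaleE jacobian_mulmxr -rescaleE /ads5.
rewrite /rescale scale_param scale_param -scalemxAr -scalemxAl; congr (_ *: _).
rewrite da2E drho2E /rescale_mx scale_block_mx !add_block_mx tr_block_mx.
rewrite !mulmx_block !trmx0 !tr_scalar_mx !scaler0.
rewrite !(mul0mx, mulmx0, addr0, add0r, mul1mx, mulmx1).
by congr block_mx; rewrite -scalar_mxM scale_scalar_mx mulr1 expr2.
Qed.

(** * Moments and the metric *)

Lemma normsq_ge0 (R : realType) n (y : 'rV[R]_n) : 0 <= normsq y.
Proof. by rewrite sumr_ge0 // => mu _; exact: sqr_ge0. Qed.

Lemma normsqN (R : realType) n (y : 'rV[R]_n) : normsq (- y) = normsq y.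
Proof. by apply: eq_bigr => mu _; rewrite mxE sqrrN. Qed.

Section moments.
Context (R : realType) (a : 'rV[R]_4) (rho : R) (rho0 : 0 < rho).
Let N (y : 'rV[R]_4) := normsq y + rho ^+ 2.

Let rho20 : 0 < rho ^+ 2. Proof. exact: exprn_gt0. Qed.

Let N_gt0 y : 0 < N y. Proof. by rewrite ltr_wpDl ?normsq_ge0. Qed.

Lemma measurable_vec4B (mu : 'I_4) :
  measurable_fun [set: @R4 R] (fun t => (vec4 t - a) 0 mu).
Proof.
under eq_fun do rewrite !mxE.
by apply: measurable_funD => //; exact: measurable_vec4.
Qed.

Lemma measurable_normsq_vec4B :
  measurable_fun [set: @R4 R] (fun t => normsq (vec4 t - a)).
Proof.
rewrite /normsq; apply: measurable_sum => i.
exact: measurable_sqr_comp (measurable_vec4B i).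
Qed.

Let measurable_N s :
  measurable_fun [set: @R4 R] (fun t => N (vec4 t - a) `^ (- s)).
Proof.
apply: (measurableT_comp (measurable_powR _)).
by apply: measurable_funD => //; exact: measurable_normsq_vec4B.
Qed.

Let integral_N s : 2 < s ->
  (\int[leb4]_t (N (vec4 t - a)%R `^ (- s))%:E =
   (pi ^+ 2 / ((s - 1) * (s - 2)) * (rho ^+ 2) `^ (2 - s))%:E)%E.
Proof.
move=> s2; rewrite -(leb4_power rho20 s2).
apply: (@leb4_translate _ a (fun y => (N y `^ (- s))%:E)).
  apply/measurable_EFinP; apply: (measurableT_comp (measurable_powR _)).
  by apply: measurable_funD => //; exact: measurable_normsq_vec4.
by move=> y; rewrite lee_fin powR_ge0.
Qed.

Lemma integrable_power s : 2 < s ->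
  leb4.-integrable [set: @R4 R] (fun t => (N (vec4 t - a) `^ (- s))%:E).
Proof.
move=> s2; apply/integrableP; split; first exact/measurable_EFinP.
under eq_integral do rewrite gee0_abs ?lee_fin ?powR_ge0 //.
by rewrite integral_N // ltry.
Qed.

Lemma Rintegral_power s : 2 < s ->
  \int[leb4]_(t in [set: @R4 R]) (N (vec4 t - a) `^ (- s)) =
  pi ^+ 2 / ((s - 1) * (s - 2)) * (rho ^+ 2) `^ (2 - s).
Proof. by move=> s2; rewrite /Rintegral integral_N. Qed.

Let power_succ s y : N y `^ (- (s + 1)) * N y = N y `^ (- s).
Proof.
rewrite -{2}[N y]powRr1 ?ltW // -powRD; last first.
  by rewrite (gt_eqF (N_gt0 y)) implybT.
by congr (_ `^ _); ring.
Qed.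

Let second_moment s y : N y `^ (- (s + 1)) * normsq y =
  N y `^ (- s) - rho ^+ 2 * N y `^ (- (s + 1)).
Proof. by rewrite -(power_succ s) /N; ring. Qed.

(** Since 0 <= (|y_mu| - rho)^2 gives rho |y_mu| <= N, the first moment is
    dominated by N^-s / rho. *)
Lemma integrable_first_moment s mu : 2 < s ->
  leb4.-integrable [set: @R4 R]
    (fun t => (N (vec4 t - a) `^ (- (s + 1)) * (vec4 t - a) 0 mu)%:E).
Proof.
move=> s2.
have hi := integrableZl measurableT rho^-1 (integrable_power s2).
apply: (le_integrable measurableT _ _ hi).
  apply/measurable_EFinP; apply: measurable_funM; first exact: measurable_N.
  exact: measurable_vec4B.
move=> t _; set y := vec4 t - a.
rewrite -EFinM !abse_EFin lee_fin !normrM.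
have rV0 : 0 <= rho^-1 by rewrite invr_ge0 ltW.
rewrite (ger0_norm rV0) (ger0_norm (powR_ge0 (N y) (- (s + 1)))).
rewrite (ger0_norm (powR_ge0 (N y) (- s))).
rewrite -(power_succ s) mulrCA ler_wpM2l ?powR_ge0 //.
rewrite ler_pdivlMl //.
have h1 : y 0 mu ^+ 2 <= normsq y.
  by rewrite /normsq (bigD1 mu) //= lerDl sumr_ge0 // => i _; exact: sqr_ge0.
have h2 : `|y 0 mu| ^+ 2 = y 0 mu ^+ 2 by rewrite real_normK ?num_real.
rewrite /N; set z := `|y 0 mu| in h2 *.
have := sqr_ge0 (z - rho); rewrite -h2 in h1.
nra.
Qed.

Lemma Rintegral_first_moment s mu :
  \int[leb4]_(t in [set: @R4 R])
    (N (vec4 t - a) `^ (- (s + 1)) * (vec4 t - a) 0 mu) = 0.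
Proof.
apply: (@leb4_odd _ a (fun y => N y `^ (- (s + 1)) * y 0 mu)).
  apply: measurable_funM; last exact: measurable_vec4.
  apply: (measurableT_comp (measurable_powR _)).
  by apply: measurable_funD => //; exact: measurable_normsq_vec4.
by move=> y; rewrite /N normsqN mxE mulrN.
Qed.

Lemma integrable_second_moment s : 2 < s ->
  leb4.-integrable [set: @R4 R]
    (fun t => (N (vec4 t - a) `^ (- (s + 1)) * normsq (vec4 t - a))%:E).
Proof.
move=> s2; have s3 : 2 < s + 1 by lra.
have h := integrableB measurableT (integrable_power s2)
  (integrableZl measurableT (rho ^+ 2) (integrable_power s3)).
under eq_fun do rewrite second_moment EFinB EFinM.
exact: h.
Qed.

(** Write |y|^2 = N - rho^2. *)
Lemma Rintegral_second_moment s : 2 < s ->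
  \int[leb4]_(t in [set: @R4 R])
    (N (vec4 t - a) `^ (- (s + 1)) * normsq (vec4 t - a)) =
  2 * pi ^+ 2 / (s * (s - 1) * (s - 2)) * (rho ^+ 2) `^ (2 - s).
Proof.
move=> s2; have s3 : 2 < s + 1 by lra.
have hi := integrableZl measurableT (rho ^+ 2) (integrable_power s3).
under eq_Rintegral do rewrite second_moment.
rewrite RintegralB //; last exact: integrable_power.
rewrite RintegralZl //; last exact: integrable_power.
rewrite !Rintegral_power //.
have -> : (rho ^+ 2) `^ (2 - s) = rho ^+ 2 * (rho ^+ 2) `^ (2 - (s + 1)).
  rewrite -{2}[rho ^+ 2]powRr1 ?ltW // -powRD; last first.
    by rewrite (gt_eqF rho20) implybT.
  by congr (_ `^ _); ring.
field.
by apply/and3P; split; rewrite gt_eqF //; lra.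
Qed.

End moments.

Lemma powR_quotient (R : realType) (alpha rho N : R) : 0 < rho -> 0 < N ->
  (16 * rho ^+ 2 / N ^+ 2) `^ alpha * (4 / N ^+ 2) =
  4 `^ (2 * alpha + 1) * rho `^ (2 * alpha) * N `^ (- (2 * alpha + 1 + 1)).
Proof.
move=> rho0 N0.
have -> : 16 * rho ^+ 2 / N ^+ 2 = (4 * rho / N) `^ 2.
  rewrite powR_mulrn ?mulr_ge0 ?invr_ge0 ?(ltW rho0) ?(ltW N0) //.
  by field; rewrite gt_eqF.
rewrite -powRrM !powRM ?mulr_ge0 ?invr_ge0 ?(ltW rho0) ?(ltW N0) //.
rewrite -powR_inv1 ?(ltW N0) // -powRrM mulN1r.
have n40 : (4 : R) != 0 by rewrite pnatr_eq0.
have N1 : N != 0 by rewrite gt_eqF.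
rewrite [in RHS]powRD ?n40 ?implybT // powRr1 //.
have -> : - (2 * alpha + 1 + 1) = - (2 * alpha) + (- 2%:R) by ring.
rewrite powRD ?N1 ?implybT // powR_invn ?(ltW N0) //.
ring.
Qed.

(** Three applications of the functional equation, from 2 alpha + 2 down to 2
    alpha - 1. *)
Lemma metricAE (R : realType) (alpha : R) : 2^-1 < alpha ->
  metricA alpha =
  4 `^ (2 * alpha + 1) * (pi ^+ 2 / ((2 * alpha + 1) * (2 * alpha))).
Proof.
move=> ha; rewrite /metricA.
have h0 : 0 < 2 * alpha - 1 by lra.
have -> : Gamma (2 * alpha + 2) =
    (2 * alpha + 1) * (2 * alpha * ((2 * alpha - 1) * Gamma (2 * alpha - 1))).
  rewrite -Gamma_rec // subrK -Gamma_rec; last lra.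
  rewrite -Gamma_rec; last lra.
  by congr Gamma; ring.
have G0 := Gamma_gt0 h0.
field.
by apply/and4P; split; rewrite gt_eqF //; lra.
Qed.

Section metric.
Context (R : realType) (alpha : R) (halpha : 2^-1 < alpha).
Context (a : 'rV[R]_4) (rho : R) (rho0 : 0 < rho).
Let N (y : 'rV[R]_4) := normsq y + rho ^+ 2.
Let s := 2 * alpha + 1.
Let C := 4 `^ (2 * alpha + 1) * rho `^ (2 * alpha).

Let N_gt0 y : 0 < N y. Proof. by rewrite ltr_wpDl ?normsq_ge0 ?exprn_gt0. Qed.
Let rho20 : 0 < rho ^+ 2. Proof. exact: exprn_gt0. Qed.
Let s2 : 2 < s. Proof. have h := halpha; rewrite /s; lra. Qed.
Let s12 : 2 < s + 1. Proof. by rewrite (lt_trans s2) // ltrDl. Qed.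

Let integrandE i j x : integrand alpha adhm (param a rho) i j x =
  C * (N (x - a) `^ (- (s + 1)) *
    dot4 (fun mu => rho * (- (lshift 1 mu == i)%:R)
                    - (rshift 4 ord0 == i)%:R * (x - a) 0 mu)
         (fun mu => rho * (- (lshift 1 mu == j)%:R)
                    - (rshift 4 ord0 == j)%:R * (x - a) 0 mu)).
Proof.
rewrite /integrand Phi_adhm // trR_param // [LHS]mulrA powR_quotient //;
  last exact: N_gt0.
by rewrite -/s -/C mulrA.
Qed.

Let d (y : 'rV[R]_4) (k : 'I_(4 + 1)) (mu : 'I_4) : R :=
  rho * (- (lshift 1 mu == k)%:R) - (rshift 4 ord0 == k)%:R * y 0 mu.

Let d_centre y k : d y (lshift 1 k) = (fun l => - rho * (l == k)%:R).
Proof.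
apply/funext => l; rewrite /d eq_rlshift mul0r subr0.
by rewrite (inj_eq (@lshift_inj _ _)) mulrN mulNr.
Qed.

Let d_scale y : d y (rshift 4 ord0) = (fun l => - y 0 l).
Proof.
by apply/funext => l; rewrite /d eq_lrshift eqxx oppr0 mulr0 add0r mul1r.
Qed.

Let integrand_aa mu nu x :
  integrand alpha adhm (param a rho) (lshift 1 mu) (lshift 1 nu) x =
  C * rho ^+ 2 * (mu == nu)%:R * N (x - a) `^ (- (s + 1)).
Proof.
by rewrite integrandE -!/(d _ _) !d_centre dot4_delta; ring.
Qed.

Let integrand_ar mu x :
  integrand alpha adhm (param a rho) (lshift 1 mu) (rshift 4 ord0) x =
  C * rho * (N (x - a) `^ (- (s + 1)) * (x - a) 0 mu).
Proof.
by rewrite integrandE -!/(d _ _) d_centre d_scale dot4_delta; ring.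
Qed.

Let integrand_ra mu x :
  integrand alpha adhm (param a rho) (rshift 4 ord0) (lshift 1 mu) x =
  C * rho * (N (x - a) `^ (- (s + 1)) * (x - a) 0 mu).
Proof.
by rewrite integrandE -!/(d _ _) dot4C d_centre d_scale dot4_delta; ring.
Qed.

Let integrand_rr x :
  integrand alpha adhm (param a rho) (rshift 4 ord0) (rshift 4 ord0) x =
  C * (N (x - a) `^ (- (s + 1)) * normsq (x - a)).
Proof.
rewrite integrandE -!/(d _ _) d_scale normsq_dot4; congr (_ * (_ * _)).
by apply: eq_bigr => mu _; rewrite mulrNN.
Qed.

Lemma integrable_integrand i j : leb4.-integrable setT
  (fun t => (integrand alpha adhm (param a rho) i j (vec4 t))%:E).
Proof.
rewrite -(splitK i) -(splitK j); case: (fintype.split i) => mu;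
  case: (fintype.split j) => nu /=; rewrite ?(ord1 mu) ?(ord1 nu).
- under eq_fun do rewrite integrand_aa EFinM.
  exact/integrableZl/integrable_power.
- under eq_fun do rewrite integrand_ar EFinM.
  exact/integrableZl/integrable_first_moment.
- under eq_fun do rewrite integrand_ra EFinM.
  exact/integrableZl/integrable_first_moment.
- under eq_fun do rewrite integrand_rr EFinM.
  exact/integrableZl/integrable_second_moment.
Qed.

Let CK : C * (rho ^+ 2) `^ (2 - s) =
  4 `^ (2 * alpha + 1) * rho `^ (2 * (1 - alpha)).
Proof.
rewrite /C -mulrA; congr (_ * _).
rewrite -powR_mulrn ?(ltW rho0) // -powRrM -powRD; last first.
  by rewrite (gt_eqF rho0) implybT.
by congr (_ `^ _); rewrite /s; ring.
Qed.

Lemma metric_adhm : metric alpha adhm (param a rho) =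
  (rho `^ (2 * (1 - alpha)) * metricA alpha) *:
    (da2 + metricB alpha *: drho2).
Proof.
have ha := halpha.
rewrite da2E drho2E scale_block_mx !scaler0 add_block_mx !addr0 add0r.
rewrite metricAE // /metricB.
apply/matrixP => i j; rewrite mxE [RHS]mxE.
rewrite -(splitK i) -(splitK j); case: (fintype.split i) => mu;
  case: (fintype.split j) => nu /=; rewrite ?(ord1 mu) ?(ord1 nu);
  rewrite ?(block_mxEul, block_mxEur, block_mxEdl, block_mxEdr) ?mxE.
- under eq_Rintegral do rewrite integrand_aa.
  rewrite RintegralZl //; last exact: integrable_power.
  rewrite Rintegral_power //.
  have e : C * rho ^+ 2 * (rho ^+ 2) `^ (2 - (s + 1)) =
      4 `^ (2 * alpha + 1) * rho `^ (2 * (1 - alpha)).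
    rewrite -CK -mulrA -{1}[rho ^+ 2]powRr1 ?(ltW rho20) // -powRD; last first.
      by rewrite (gt_eqF rho20) implybT.
    by congr (_ * _ `^ _); ring.
  rewrite [LHS](_ : _ = C * rho ^+ 2 * (rho ^+ 2) `^ (2 - (s + 1)) *
    (pi ^+ 2 / ((s + 1 - 1) * (s + 1 - 2)) * (mu == nu)%:R)); last by ring.
  rewrite e /s; field.
  by apply/andP; split; rewrite gt_eqF //; lra.
- under eq_Rintegral do rewrite integrand_ar.
  rewrite RintegralZl ?Rintegral_first_moment ?mulr0 //.
  exact: integrable_first_moment.
- under eq_Rintegral do rewrite integrand_ra.
  rewrite RintegralZl ?Rintegral_first_moment ?mulr0 //.
  exact: integrable_first_moment.
- under eq_Rintegral do rewrite integrand_rr.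
  rewrite RintegralZl //; last exact: integrable_second_moment.
  rewrite Rintegral_second_moment //.
  rewrite [LHS](_ : _ = C * (rho ^+ 2) `^ (2 - s) *
    (2 * pi ^+ 2 / (s * (s - 1) * (s - 2)))); last by ring.
  rewrite CK /s eqxx mulr1n; field.
  by apply/and3P; split; rewrite gt_eqF //; lra.
Qed.

End metric.

Theorem mainTheorem2 (R : realType) :
  (forall (alpha : R), 2^-1 < alpha ->
   forall (a : 'rV[R]_4) (rho : R), 0 < rho ->
     (forall i j : 'I_(4 + 1),
        leb4.-integrable setT
          (fun t => (integrand alpha adhm (param a rho) i j (vec4 t))%:E)) /\
     metric alpha adhm (param a rho) =
       (rho `^ (2 * (1 - alpha)) * metricA alpha) *:
         (da2 + metricB alpha *: drho2)) /\
  (exists c k : R, 0 < c /\ 0 < k /\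
   forall (a : 'rV[R]_4) (rho : R), 0 < rho ->
     metric 2 adhm (param a rho) =
       k *: pullback (rescale c) ads5 (param a rho)).
Proof.
split.
  move=> alpha halpha a rho rho0; split.
    by move=> i j; exact: integrable_integrand.
  exact: metric_adhm.
have h2 : 2^-1 < 2 :> R by lra.
have c20 : 0 < 2 / 3 :> R by lra.
have A0 : 0 < metricA (2 : R).
  rewrite metricAE // mulr_gt0 ?powR_gt0 ?ltr0n //.
  rewrite divr_gt0 ?exprn_gt0 ?pi_gt0 //; lra.
(* c^2 is B(2), and k absorbs the factor c^-2 of the pulled-back metric. *)
exists (Num.sqrt (2 / 3)), (metricA 2 * (2 / 3)).
split; first by rewrite sqrtr_gt0.
split; first exact: mulr_gt0.
move=> a rho rho0.
rewrite metric_adhm // pullback_ads5 scalerA.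
rewrite exprMn sqr_sqrtr ?ltW //.
have -> : metricB 2 = 2 / 3 :> R by rewrite /metricB; congr (_ / _); ring.
congr (_ *: _).
have -> : 2 * (1 - 2) = - 2%:R :> R by ring.
rewrite powR_invn ?ltW // invfM.
field.
by rewrite gt_eqF.
Qed.
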